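(* Let $d \ge 1$ be an integer, and let $R \subseteq (0,\infty)$ and $Y, Z \subseteq \mathbb{R}^d$ be non-empty compact sets. Let $$\delta = \max\{\dim_F(RY)+\dim_H(Z),\ \dim_H(RY)+\dim_F(Z)\}.$$ (a) If $\delta > d$, then $\mathcal{L}_d(RY+Z) > 0$. (b) If $\delta \leq d$, then $\dim_H(RY+Z) \geq \delta$.
   Context: Here $RY = \{ry : r\in R,\ y \in Y\}$ and $RY+Z = \{ry+z : r \in R,\ y\in Y,\ z \in Z\}$. $\mathcal{L}_d$ is $d$-dimensional Lebesgue measure. For $A \subseteq \mathbb{R}^d$, $\mathcal{M}(A)$ is the set of non-zero finite Borel measures on $\mathbb{R}^d$ with compact support contained in $A$. The Fourier transform is $\widehat{\mu}(\xi) = \int e^{-2\pi i x\cdot \xi}\,d\mu(x)$. $\dim_H(A)$ is Hausdorff dimension; for Borel $A\subseteq\mathbb{R}^d$ it equals $\sup\{0<s<d : I_s(\mu)<\infty \text{ for some } \mu \in \mathcal{M}(A)\}$, where $I_s(\mu) = \iint |x-y|^{-s}\,d\mu(x)\,d\mu(y)$. The Fourier dimension of a Borel set $A \subseteq \mathbb{R}^d$ is $\dim_F(A) = \sup\{0<s<d : \sup_{\xi\in\mathbb{R}^d} |\widehat{\mu}(\xi)|^2|\xi|^s < \infty \text{ for some } \mu\in\mathcal{M}(A)\}$. The supremum of the empty set is taken to be $0$. *)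

(* Defs.v *)
From HB Require Import structures.
From mathcomp Require Import all_boot all_order all_algebra.
From mathcomp Require Import all_classical all_reals all_analysis.
From mathcomp.real_closed Require Import complex.

Set Implicit Arguments.
Unset Strict Implicit.
Unset Printing Implicit Defensive.

Import Order.TTheory GRing.Theory Num.Theory.
Import numFieldNormedType.Exports.

Local Open Scope classical_set_scope.
Local Open Scope ring_scope.

(* Vectors of R^d are row vectors.  The library norm `|x| on 'rV[R]_d is the
   sup norm: it induces the usual topology, but the metric quantities below
   use the Euclidean norm. *)
Section Euclidean.
Context {R : realType} {d : nat}.
Implicit Types (x y : 'rV[R]_d) (A : set 'rV[R]_d).

Definition dotp x y : R := \sum_(j < d) x 0 j * y 0 j.

Definition enorm x : R := Num.sqrt (dotp x x).

(* ereal_sup set0 = -oo, so diam set0 = -oo. *)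
Definition diam A : \bar R :=
  ereal_sup [set (enorm (p.1 - p.2))%:E | p in A `*` A].

Definition box (a b : 'rV[R]_d) : set 'rV[R]_d :=
  [set x : 'rV[R]_d | forall j, a 0 j <= x 0 j <= b 0 j].

(* The usual outer measure by countable covers with boxes; on (Lebesgue or
   Borel) measurable sets it is d-dimensional Lebesgue measure. *)
Definition lebesgue_rV A : \bar R :=
  ereal_inf [set (\sum_(0 <= k <oo) (\prod_(j < d) (c.2 k 0 j - c.1 k 0 j))%:E)%E
    | c in [set c : (nat -> 'rV[R]_d) * (nat -> 'rV[R]_d) |
        (forall k j, c.1 k 0 j <= c.2 k 0 j) /\
        A `<=` \bigcup_k box (c.1 k) (c.2 k)]].

(* diam(U)^s, with 0^0 = 1 for nonempty U (so that the 0-dimensional Hausdorff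
   measure is the counting measure), and 0 for U empty. *)
Definition diam_pow (s : R) (U : set 'rV[R]_d) : \bar R :=
  if U == set0 then 0%E else poweR (diam U) s.

Definition hausdorff_content (s delta : R) A : \bar R :=
  ereal_inf [set (\sum_(0 <= k <oo) diam_pow s (U k))%E
    | U in [set U : nat -> set 'rV[R]_d |
        (forall k, (diam (U k) <= delta%:E)%E) /\ A `<=` \bigcup_k U k]].

Definition hausdorff_measure (s : R) A : \bar R :=
  ereal_sup [set hausdorff_content s delta A | delta in [set delta | 0 < delta]].

(* A real infimum: the set contains every s > d, hence is never empty, and it
   is bounded below by 0. *)
Definition hausdorff_dim A : R :=
  inf [set s | 0 <= s /\ hausdorff_measure s A = 0%E].

End Euclidean.

Notation borel_rV R d := (g_sigma_algebraType (@open 'rV[R]_d)).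

Section Fourier.
Context {R : realType} {d : nat}.
Implicit Types (mu : {finite_measure set (borel_rV R d) -> \bar R})
  (A : set 'rV[R]_d).

Definition msupport mu : set 'rV[R]_d :=
  [set x | forall U : set 'rV[R]_d, open U -> U x -> (0 < mu U)%E].

Definition measures_on A : set {finite_measure set (borel_rV R d) -> \bar R} :=
  [set mu : {finite_measure set _ -> \bar R} |
    [/\ mu setT != 0%E, compact (msupport mu) & msupport mu `<=` A]].

Definition cis (t : R) : R[i] := (cos t +i* sin t)%C.

Definition cintegral mu (f : 'rV[R]_d -> R[i]) : R[i] :=
  ((\int[mu]_x complex.Re (f x))%R +i* (\int[mu]_x complex.Im (f x))%R)%C.

Definition fourier mu (xi : 'rV[R]_d) : R[i] :=
  cintegral mu (fun x => cis (- (2 * pi * dotp x xi))).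

(* A real supremum, so that the supremum of the empty set is 0; the set is
   bounded above by d. *)
Definition fourier_dim A : R :=
  sup [set s | 0 < s < d%:R /\
    exists2 mu, measures_on A mu &
      (ereal_sup [set (ComplexField.Normc.normc (fourier mu xi) ^+ 2 *
                       enorm xi `^ s)%:E | xi in setT] < +oo)%E].

End Fourier.

Definition scale_set {R : realType} {d : nat} (S : set R) (Y : set 'rV[R]_d) :
    set 'rV[R]_d :=
  [set r *: y | r in S & y in Y].

Definition sum_set {R : realType} {d : nat} (A B : set 'rV[R]_d) :
    set 'rV[R]_d :=
  [set a + b | a in A & b in B].

(* Main.v *)
Require Import Defs.
From mathcomp Require Import all_boot all_order all_algebra.
From mathcomp Require Import all_classical all_reals all_analysis.
From mathcomp Require Import ring lra zify.
From mathcomp.real_closed Require Import complex.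
From mathcomp Require finmap.
Import Order.TTheory GRing.Theory Num.Theory.
Import numFieldNormedType.Exports.
Local Open Scope classical_set_scope.
Local Open Scope ring_scope.

Set Implicit Arguments.
Unset Strict Implicit.
Unset Printing Implicit Defensive.

(** With [A = RY] and [B = Z] only compactness of [A] and [B] matters.  Fix
    [s < dim_F A] and [t < dim_H B].  At each scale [2^-n] one works with finitely
    supported probability weights, with constants independent of [n]: on [A] by
    discretizing a measure with [|mu^(xi)|^2 <= C |xi|^-s], on [B] by a finite
    Frostman construction giving every dyadic cube of side [2^-i], [i <= n], mass
    at most [C 2^(-it)].  Products of Fejér kernels are nonnegative trigonometric
    polynomials with integer frequencies, so the pair energy of the convolution at
    scale [2^-j] is at most [C 2^(-jd)] times the sum of [|mu^|^2 |nu^|^2] over the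
    integer frequencies of size at most [2^j].  Fejér decay and the Frostman bound
    give [C 2^(i(d-t))] for the sum of [|nu^|^2] over frequencies of size [2^i], so
    summing over dyadic shells the energy is [O(2^(-j(s+t)))] if [s + t < d] and
    [O(2^(-jd))] if [s + t > d].  By Markov's inequality half of the mass lies at
    points whose neighbourhoods have mass controlled by the energy, which bounds
    from below any cover of [A + B]; covers are reduced to finite ones by
    compactness. *)

(** * Fejér kernels *)

(** Finite weights replace limits of measures: each Fourier identity used is a finite trigonometric
    sum, so convolution measures, weak limits and Plancherel on R^d never enter. The price is that
    no single family of weights serves all scales. A cover of [A + B] is therefore made finite
    first, the sizes of its members then dictate [n], and only then are the weights taken; this is
    why constants must not depend on [n]. The kernels are 1-periodic while the points fill a large
    cube. When near pairs are bounded by the energy, distant pairs congruent modulo 1 only add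
    nonnegative terms; when the energy is bounded by cell masses, the finitely many integer
    translates cost a constant factor. Dyadic shells contribute a geometric progression of ratio
    [2^(d-s-t)]. Ratio 1 would produce a logarithm, and is avoided by choosing [s] and [t] with
    [s + t] strictly on one side of [d]. Volume needs one scale only, whereas a Hausdorff cover
    mixes sizes and needs points that are good at all scales at once. *)

Section Trig.
Context {K : realType}.
Implicit Types (x u v : K) (N : nat).

Lemma sqr_cos_ge_half x : - (pi / 4) <= x <= pi / 4 -> 1 / 2 <= cos x ^+ 2.
Proof.
move=> /andP[h1 h2].
have : 0 <= cos (x *+ 2) by apply: cos_ge0_pihalf; apply/andP; split; lra.
rewrite cos_mulr2n; lra.
Qed.

(** Halving the angle, [sin x = 2 sin y cos y] with [y = x/2]; the mean value theorem gives
    [sin y >= y cos y], whence [sin x >= 2 y cos(y)^2 >= y]. *)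
Lemma sin_ge_half x : 0 <= x <= pi / 2 -> x / 2 <= sin x.
Proof.
move=> /andP[h0 h1]; have pi0 := @pi_gt0 K.
have -> : x = (x / 2) *+ 2 by rewrite mulr2n; lra.
rewrite sin_mulr2n; set y := x / 2.
have y0 : 0 <= y by rewrite /y; lra.
have y1 : y <= pi / 4 by rewrite /y; lra.
have cy : 1 / 2 <= cos y ^+ 2 by apply: sqr_cos_ge_half; apply/andP; split; lra.
have c0 : 0 <= cos y by apply: cos_ge0_pihalf; apply/andP; split; lra.
have [c cin /eqP] : exists2 c, c \in `[0, y]%R & sin y - sin 0 = cos c * (y - 0).
  apply: MVT_segment => //.
  by apply: continuous_subspaceT; exact: continuous_sin.
rewrite sin0 !subr0 => /eqP ->.
move: cin; rewrite in_itv /= => /andP[c1 c2].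
have : cos y <= cos c.
  rewrite leNgt ltr_cos ?in_itv /=; first by rewrite -leNgt.
    apply/andP; split; lra.
  apply/andP; split; lra.
move=> h.
have : cos y * (cos c * y) >= cos y * (cos y * y).
  by rewrite ler_wpM2l// ler_wpM2r.
rewrite mulr2n; nra.
Qed.

(** Squared modulus of the sum of [e^(2 pi i k u)] over [k < N], that is [N] times the usual Fejér
    kernel. Unnormalized, its Fourier coefficients count representations as differences. *)
Definition fejer N u : K :=
  (\sum_(k < N) cos (2 * pi * (k%:R * u))) ^+ 2 +
  (\sum_(k < N) sin (2 * pi * (k%:R * u))) ^+ 2.

Lemma fejer_ge0 N u : 0 <= fejer N u.
Proof. by rewrite addr_ge0 ?sqr_ge0. Qed.

Lemma fejer_le N u : fejer N u <= 2 * N%:R ^+ 2.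
Proof.
have H (f : K -> K) : (forall x, `|f x| <= 1) ->
    (\sum_(k < N) f (2 * pi * (k%:R * u))) ^+ 2 <= N%:R ^+ 2.
  move=> f1; rewrite -real_normK ?num_real// lerXn2r ?nnegrE//.
  apply: le_trans (ler_norm_sum _ _ _) _.
  apply: le_trans (ler_sum _ (fun i _ => f1 _)) _.
  by rewrite sumr_const card_ord.
by rewrite mulr_natl mulr2n lerD// H//; [exact: cos_max|exact: sin_max].
Qed.

Lemma fejerD N u (z : nat) : fejer N (u + z%:R) = fejer N u.
Proof.
have E (k : nat) : 2 * pi * (k%:R * (u + z%:R)) =
    2 * pi * (k%:R * u) + (pi *+ 2) *+ (k * z) :> K.
  by rewrite -[_ *+ (k * z)]mulr_natl -[pi *+ 2]mulr_natl natrM; ring.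
rewrite /fejer; congr (_ ^+ 2 + _ ^+ 2); apply: eq_bigr => k _; rewrite E.
  exact: (periodicn (@cosD2pi K)).
exact: (periodicn (@sinD2pi K)).
Qed.

(** Multiplication by [2 sin(pi u)] telescopes both sums and avoids dividing by a sine that vanishes
    at integers. *)
Lemma fejer_sin N u : fejer N u * sin (pi * u) ^+ 2 <= 2.
Proof.
have Hc : 2 * sin (pi * u) * \sum_(k < N) cos (2 * pi * (k%:R * u)) =
    sin ((2 * N%:R - 1) * (pi * u)) + sin (pi * u).
  elim: N => [|N IH].
    by rewrite big_ord0 mulr0 mulr0 sub0r mulN1r sinN addNr.
  rewrite big_ord_recr /= mulrDr IH.
  have -> : (2 * N.+1%:R - 1) * (pi * u) = 2 * pi * (N%:R * u) + pi * u.
    by rewrite -natr1; ring.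
  have -> : (2 * N%:R - 1) * (pi * u) = 2 * pi * (N%:R * u) - pi * u by ring.
  by rewrite sinB sinD; ring.
have Hs : 2 * sin (pi * u) * \sum_(k < N) sin (2 * pi * (k%:R * u)) =
    cos (pi * u) - cos ((2 * N%:R - 1) * (pi * u)).
  elim: N {Hc} => [|N IH].
    by rewrite big_ord0 mulr0 mulr0 sub0r mulN1r cosN subrr.
  rewrite big_ord_recr /= mulrDr IH.
  have -> : (2 * N.+1%:R - 1) * (pi * u) = 2 * pi * (N%:R * u) + pi * u.
    by rewrite -natr1; ring.
  have -> : (2 * N%:R - 1) * (pi * u) = 2 * pi * (N%:R * u) - pi * u by ring.
  by rewrite cosB cosD; ring.
move: Hc Hs; rewrite /fejer.
set s := sin (pi * u); set c := cos (pi * u).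
set s' := sin ((_ - _) * _); set c' := cos ((_ - _) * _).
set C := \sum_(k < N) _; set S := \sum_(k < N) _ => Hc Hs.
have e1 : c ^+ 2 + s ^+ 2 = 1 by exact: cos2Dsin2.
have e2 : c' ^+ 2 + s' ^+ 2 = 1 by exact: cos2Dsin2.
have -> : (C ^+ 2 + S ^+ 2) * s ^+ 2 =
  ((2 * s * C) ^+ 2 + (2 * s * S) ^+ 2) / 4 by field.
rewrite Hc Hs.
(* Parallelogram law: the two squares add up to 4 minus the two squares introduced here. *)
have := sqr_ge0 (s' - s); have := sqr_ge0 (c + c').
have -> : (s' + s) ^+ 2 + (c - c') ^+ 2 = 2 * (c ^+ 2 + s ^+ 2) +
    2 * (c' ^+ 2 + s' ^+ 2) - (s' - s) ^+ 2 - (c + c') ^+ 2 by ring.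
rewrite e1 e2; lra.
Qed.

(** For [N |v| <= 1] the trivial bound suffices. Otherwise [sin(pi |v|) >= |v|] turns [fejer_sin]
    into [fejer N v <= 2 / v^2], and [1 + N |v| <= 2 N |v|]. *)
Lemma fejer_decay N v : `|v| <= 1 / 2 -> fejer N v <= 8 * N%:R ^+ 2 / (1 + N%:R * `|v|) ^+ 2.
Proof.
move=> hv; have N0 : 0 <= N%:R :> K by [].
have v0 : 0 <= `|v| by [].
have D0 : 0 < (1 + N%:R * `|v|) ^+ 2 by rewrite exprn_gt0// ltr_wpDr// mulr_ge0.
rewrite ler_pdivlMr//.
have [h|h] := leP (N%:R * `|v|) 1.
  have : (1 + N%:R * `|v|) ^+ 2 <= 4.
    have : 0 <= N%:R * `|v| by rewrite mulr_ge0.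
    nra.
  have := fejer_le N v; have := fejer_ge0 N v; have := sqr_ge0 (N%:R : K); nra.
have hs : `|v| ^+ 2 <= sin (pi * v) ^+ 2.
  have pi2 := @pi_ge2 K.
  have s1 : `|v| <= sin (pi * `|v|).
    suff : pi * `|v| / 2 <= sin (pi * `|v|) by nra.
    by apply: sin_ge_half; apply/andP; split; nra.
  have -> : sin (pi * v) ^+ 2 = sin (pi * `|v|) ^+ 2.
    by case: (ger0P v) => // _; rewrite mulrN sinN sqrrN.
  by rewrite lerXn2r ?nnegrE// (le_trans v0).
have h2 : (1 + N%:R * `|v|) ^+ 2 <= 4 * N%:R ^+ 2 * `|v| ^+ 2.
  rewrite -mulrA -exprMn; move: h; set w := N%:R * `|v|; nra.
have := fejer_sin N v; have F0 := fejer_ge0 N v.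
have : fejer N v * `|v| ^+ 2 <= fejer N v * sin (pi * v) ^+ 2 by rewrite ler_wpM2l.
move=> a b.
have : fejer N v * (1 + N%:R * `|v|) ^+ 2 <= fejer N v * (4 * N%:R ^+ 2 * `|v| ^+ 2) by rewrite ler_wpM2l.
have : (4 * N%:R ^+ 2) * (fejer N v * `|v| ^+ 2) <= (4 * N%:R ^+ 2) * 2.
  by rewrite ler_wpM2l ?mulr_ge0 ?sqr_ge0// (le_trans a).
lra.
Qed.

(** All phases [2 pi k u], [k < N], stay in [-pi/4, pi/4], so the cosines do not cancel and already
    their sum is at least [N cos(pi/4)]. *)
Lemma fejer_ge N u : `|u| * (8 * N%:R) <= 1 -> N%:R ^+ 2 / 2 <= fejer N u.
Proof.
move=> h; rewrite /fejer.
have pi0 := @pi_gt0 K.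
have c0 : 0 <= cos (pi / 4) :> K by apply: cos_ge0_pihalf; apply/andP; split; lra.
have c1 : 1 / 2 <= cos (pi / 4) ^+ 2 :> K by apply: sqr_cos_ge_half; apply/andP; split; lra.
have : N%:R * cos (pi / 4) <= \sum_(k < N) cos (2 * pi * (k%:R * u)).
  have -> : N%:R * cos (pi / 4) = \sum_(k < N) cos (pi / 4) :> K.
    by rewrite sumr_const card_ord mulr_natl.
  apply: ler_sum => k _.
  rewrite -(cos_norm (2 * _ * _)) !normrM !normr_nat (ger0_norm (ltW pi0)).
  have hk : k%:R * `|u| * 8 <= 1.
    have kN : k%:R * `|u| <= N%:R * `|u| by rewrite ler_wpM2r// ler_nat ltnW.
    by apply: le_trans h; nra.
  have k0 : 0 <= k%:R * `|u| by rewrite mulr_ge0.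
  rewrite leNgt ltr_cos ?in_itv /= -?leNgt; last 2 first.
  - by apply/andP; split; lra.
  - by apply/andP; split; nra.
  nra.
move=> hC; set C := \sum_(_ < _) _ in hC *.
have N0 : 0 <= N%:R * cos (pi / 4) :> K by rewrite mulr_ge0.
have : (N%:R * cos (pi / 4)) ^+ 2 <= C ^+ 2 by rewrite lerXn2r ?nnegrE// (le_trans N0).
rewrite exprMn.
have := sqr_ge0 (N%:R : K).
have := sqr_ge0 (\sum_(k < N) sin (2 * pi * (k%:R * u))).
nra.
Qed.

End Trig.

(** * Sums over boxes of integer frequencies *)

Section FiniteSums.
Context {K : realType}.

Lemma ler_sum_inj (I J : finType) (P : pred I) (phi : I -> J) (G : J -> K) :
  {in P &, injective phi} -> (forall j, 0 <= G j) ->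
  \sum_(i | P i) G (phi i) <= \sum_j G j.
Proof.
move=> phi_inj G0.
rewrite -(big_imset (h := phi) (A := P) G)//=.
rewrite [leRHS](bigID (mem [set phi x | x in P]%SET)) /=.
by rewrite lerDl sumr_ge0.
Qed.

Context {d : nat}.
Implicit Types (g h : 'rV[K]_d -> K) (M N : nat).

(** The frequencies of a product of [d] Fejér kernels, listed with multiplicity. *)
Definition diff_freq N (f : {ffun 'I_d -> 'I_N * 'I_N}) : 'rV[K]_d :=
  \row_j ((f j).1%:R - (f j).2%:R).

Definition box_freq M (k : {ffun 'I_d -> 'I_(2 * M).+1}) : 'rV[K]_d :=
  \row_j ((k j)%:R - M%:R).

(** An integer is a difference of two elements of {0, ..., N} in at most [N + 1] ways, since the
    subtracted element and the difference determine the pair; [phi] records these two. *)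
Lemma sum_diff_freq_le N g : (forall x, 0 <= g x) ->
  \sum_f g (@diff_freq N.+1 f) <= N.+1%:R ^+ d * \sum_k g (@box_freq N k).
Proof.
move=> g0.
pose phi (f : {ffun 'I_d -> 'I_N.+1 * 'I_N.+1}) :
    {ffun 'I_d -> 'I_N.+1} * {ffun 'I_d -> 'I_(2 * N).+1} :=
  ([ffun j => (f j).2], [ffun j => inord (N + (f j).1 - (f j).2)]).
have phiE f j : (((phi f).2 j : nat) = N + (f j).1 - (f j).2)%N.
  rewrite /phi /= ffunE inordK// ltnS; have := ltn_ord (f j).1; lia.
have le2 (f : {ffun 'I_d -> 'I_N.+1 * 'I_N.+1}) j : ((f j).2 <= N + (f j).1)%N.
  by have := ltn_ord (f j).2; lia.
have -> : N.+1%:R ^+ d * \sum_k g (@box_freq N k) =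
    \sum_(q : {ffun 'I_d -> 'I_N.+1} * {ffun 'I_d -> 'I_(2 * N).+1})
      g (box_freq q.2).
  rewrite -(pair_bigA _ (fun _ k => g (box_freq k))) /= sumr_const.
  by rewrite card_ffun !card_ord -[RHS]mulr_natl natrX.
have -> : \sum_f g (@diff_freq N.+1 f) = \sum_f g (box_freq (phi f).2).
  apply: eq_bigr => f _; congr g; apply/rowP => j; rewrite !mxE phiE.
  by rewrite natrB ?le2// natrD; ring.
apply: (@ler_sum_inj _ _ predT phi (fun q => g (box_freq q.2))) => // f1 f2 _ _.
move=> e; apply/ffunP => j.
have e2 : (f1 j).2 = (f2 j).2 by case: e => /ffunP /(_ j); rewrite !ffunE.
have e1 : (f1 j).1 = (f2 j).1.
  apply/val_inj => /=.
  have := congr1 snd e => /ffunP /(_ j) /(congr1 val) /=; rewrite !phiE e2.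
  have := le2 f1 j; have := le2 f2 j; rewrite e2.
  by move=> h2 h1 /(congr1 (addn^~ (f2 j).2)); rewrite !subnK// => /addnI.
by rewrite [f1 j]surjective_pairing [f2 j]surjective_pairing e1 e2.
Qed.

(** Conversely, [x] in [-M, M] equals [(x + M + m) - (M + m)] for each of the [M + 1] values
    [0 <= m <= M]. The terms reach [3 M], hence the length [(3 * M).+1]. *)
Lemma sum_box_freq_le M g : (forall x, 0 <= g x) ->
  M.+1%:R ^+ d * \sum_k g (@box_freq M k) <= \sum_f g (@diff_freq (3 * M).+1 f).
Proof.
move=> g0.
have -> : M.+1%:R ^+ d * \sum_k g (@box_freq M k) =
    \sum_(q : {ffun 'I_d -> 'I_M.+1} * {ffun 'I_d -> 'I_(2 * M).+1})
      g (box_freq q.2).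
  rewrite -(pair_bigA _ (fun _ k => g (box_freq k))) /= sumr_const.
  by rewrite card_ffun !card_ord -[RHS]mulr_natl natrX.
pose phi (q : {ffun 'I_d -> 'I_M.+1} * {ffun 'I_d -> 'I_(2 * M).+1}) :
    {ffun 'I_d -> 'I_(3 * M).+1 * 'I_(3 * M).+1} :=
  [ffun j => (inord (q.1 j + q.2 j), inord (q.1 j + M))].
have phi1 q j : ((phi q j).1 = q.1 j + q.2 j :> nat)%N.
  rewrite /phi ffunE /= inordK//.
  by have := ltn_ord (q.1 j); have := ltn_ord (q.2 j); lia.
have phi2 q j : ((phi q j).2 = q.1 j + M :> nat)%N.
  by rewrite /phi ffunE /= inordK//; have := ltn_ord (q.1 j); lia.
have -> : \sum_(q : {ffun 'I_d -> 'I_M.+1} * {ffun 'I_d -> 'I_(2 * M).+1})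
      g (box_freq q.2) = \sum_q g (diff_freq (phi q)).
  apply: eq_bigr => q _; congr g; apply/rowP => j; rewrite !mxE phi1 phi2.
  by rewrite !natrD; ring.
apply: (@ler_sum_inj _ _ predT phi (fun q => g (diff_freq q))) => // q1 q2 _ _ e.
have e1 j : (q1.1 j = q2.1 j :> nat)%N.
  by have /ffunP /(_ j) /(congr1 snd) /(congr1 val) /= := e; rewrite !phi2 => /addIn.
have e2 j : (q1.2 j = q2.2 j :> nat)%N.
  have /ffunP /(_ j) /(congr1 fst) /(congr1 val) /= := e.
  by rewrite !phi1 e1 => /addnI.
rewrite [q1]surjective_pairing [q2]surjective_pairing; congr pair.
  by apply/ffunP => j; apply/val_inj; exact: e1.
by apply/ffunP => j; apply/val_inj; exact: e2.
Qed.

(** The step from one dyadic box to the next: on the shell [g] is controlled pointwise, while [h] is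
    controlled only on average and is summed over the whole larger box. *)
Lemma sum_box_freq_split M g h (c : K) : (forall x, 0 <= g x) ->
  (forall x, 0 <= h x) -> 0 <= c ->
  (forall x : 'rV[K]_d, (exists j, M%:R < `|x 0 j|) -> (forall j, `|x 0 j| <= (2 * M)%:R) ->
    g x <= c) ->
  \sum_k g (@box_freq (2 * M) k) * h (box_freq k) <=
  \sum_k g (@box_freq M k) * h (box_freq k) + c * \sum_k h (@box_freq (2 * M) k).
Proof.
move=> g0 h0 c0 gc.
(* Indices of the larger box are shifted by [2 M], so [P] selects the frequencies with all
   coordinates in [-M, M]. *)
pose P (k : {ffun 'I_d -> 'I_(2 * (2 * M)).+1}) :=
  [forall j, (M <= k j <= 3 * M)%N].
rewrite (bigID P) /= lerD//.
  pose phi (k : {ffun 'I_d -> 'I_(2 * (2 * M)).+1}) : {ffun 'I_d -> 'I_(2 * M).+1} :=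
    [ffun j => inord (k j - M)].
  have phiE k j : P k -> (phi k j = k j - M :> nat)%N.
    by move=> /forallP /(_ j) ?; rewrite /phi ffunE inordK//; lia.
  rewrite (eq_bigr (fun k => g (box_freq (phi k)) * h (box_freq (phi k)))); last first.
    move=> k Pk; have -> // : box_freq k = box_freq (phi k).
    apply/rowP => j; rewrite !mxE phiE// natrB ?natrM; first by ring.
    by move/forallP: Pk => /(_ j) /andP[].
  apply: (@ler_sum_inj _ _ P phi (fun k => g (box_freq k) * h (box_freq k))).
    move=> k1 k2 P1 P2 e; apply/ffunP => j; apply/val_inj => /=.
    have /ffunP /(_ j) /(congr1 val) /= := e; rewrite !phiE//.
    by move/forallP: P1 => /(_ j) ?; move/forallP: P2 => /(_ j) ?; lia.
  by move=> k; rewrite mulr_ge0.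
apply: (@le_trans _ _ (\sum_(k | ~~ P k) c * h (@box_freq (2 * M) k))).
  apply: ler_sum => k /forallPn[j Pj]; rewrite ler_wpM2r// gc//.
    exists j; rewrite !mxE ltr_normr ltrBrDr opprB ltrBrDl -!natrD !ltr_nat.
    by move: Pj; lia.
  move=> i; rewrite !mxE ler_norml; apply/andP; split.
    by rewrite lerBrDl subrr.
  by rewrite lerBlDr -natrD ler_nat; have := ltn_ord (k i); lia.
rewrite mulr_sumr [leRHS](bigID P)/= lerDr sumr_ge0// => k _.
by rewrite mulr_ge0.
Qed.

End FiniteSums.

(** * Spectral identities for finite weighted point sets *)

Section Spectral.
Context {K : realType}.

Lemma cisD (s t : K) : cis (s + t) = cis s * cis t.
Proof. by rewrite /cis cosD sinD; apply/eqP; rewrite eq_complex /= eqxx addrC eqxx. Qed.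

Lemma cis_sum (I : finType) (f : I -> K) : cis (\sum_i f i) = \prod_i cis (f i).
Proof.
apply: (big_morph (@cis K) cisD).
by rewrite /cis cos0 sin0.
Qed.

Lemma Re_sum (I : finType) (f : I -> K[i]) :
  complex.Re (\sum_i f i) = \sum_i complex.Re (f i).
Proof. by apply: (big_morph (@complex.Re K)) => // -[a b] [c e]. Qed.

Lemma Im_sum (I : finType) (f : I -> K[i]) :
  complex.Im (\sum_i f i) = \sum_i complex.Im (f i).
Proof. by apply: (big_morph (@complex.Im K)) => // -[a b] [c e]. Qed.

Lemma fejer_cis N (v : K) : ((fejer N v)%:C)%C =
  \sum_(q : 'I_N * 'I_N) cis (2 * pi * ((q.1%:R - q.2%:R) * v)).
Proof.
have E (k l : nat) : 2 * pi * ((k%:R - l%:R) * v) =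
  2 * pi * (k%:R * v) - 2 * pi * (l%:R * v) by ring.
apply/eqP; rewrite eq_complex Re_sum Im_sum /=; apply/andP; split; apply/eqP.
  rewrite -(pair_bigA _ (fun k l : 'I_N => cos (2 * pi * ((k%:R - l%:R) * v)))) /=.
  rewrite /fejer !expr2 !big_distrlr -big_split /=; apply: eq_bigr => k _.
  by rewrite -big_split; apply: eq_bigr => l _; rewrite E cosB.
rewrite -(pair_bigA _ (fun k l : 'I_N => sin (2 * pi * ((k%:R - l%:R) * v)))) /=.
under eq_bigr do under eq_bigr do rewrite E sinB.
under eq_bigr do rewrite sumrB.
rewrite sumrB [X in _ - X]exchange_big /=; symmetry.
apply/eqP; rewrite subr_eq0; apply/eqP.
by apply: eq_bigr => k _; apply: eq_bigr => l _; rewrite mulrC.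
Qed.

Context {d : nat}.

Lemma prod_fejer N (u : 'rV[K]_d) : \prod_j fejer N (u 0 j) =
  \sum_f cos (2 * pi * dotp u (@diff_freq K d N f)).
Proof.
transitivity (complex.Re (\prod_j ((fejer N (u 0 j))%:C)%C)).
  by rewrite -(big_morph (real_complex K) (rmorphM _) (rmorph1 _)).
under eq_bigr do rewrite fejer_cis.
rewrite bigA_distr_bigA /= Re_sum; apply: eq_bigr => f _.
rewrite -cis_sum /=; congr cos; rewrite /dotp mulr_sumr.
by apply: eq_bigr => j _; rewrite !mxE; congr (_ * _); rewrite mulrC.
Qed.

Context {I : finType}.
Implicit Types (w : I -> K) (p : I -> 'rV[K]_d) (xi : 'rV[K]_d).

(** Squared modulus of the Fourier transform of the discrete measure with mass [w i] at [p i]. *)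
Definition ft2 w p xi : K :=
  (\sum_i w i * cos (2 * pi * dotp (p i) xi)) ^+ 2 +
  (\sum_i w i * sin (2 * pi * dotp (p i) xi)) ^+ 2.

Lemma ft2_ge0 w p xi : 0 <= ft2 w p xi.
Proof. by rewrite addr_ge0 ?sqr_ge0. Qed.

Lemma dotpBl (x y xi : 'rV[K]_d) : dotp (x - y) xi = dotp x xi - dotp y xi.
Proof. by rewrite /dotp -sumrB; apply: eq_bigr => j _; rewrite !mxE mulrBl. Qed.

Lemma dotpDl (x y xi : 'rV[K]_d) : dotp (x + y) xi = dotp x xi + dotp y xi.
Proof. by rewrite /dotp -big_split; apply: eq_bigr => j _; rewrite !mxE mulrDl. Qed.

Lemma ft2E w p xi : ft2 w p xi =
  \sum_i \sum_i' w i * w i' * cos (2 * pi * dotp (p i - p i') xi).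
Proof.
rewrite /ft2 !expr2 !big_distrlr -big_split /=; apply: eq_bigr => i _.
rewrite -big_split; apply: eq_bigr => i' _ /=.
by rewrite dotpBl mulrBr cosB; ring.
Qed.

(** A finite Plancherel identity. Since the terms on the right are nonnegative, frequencies may
    later be added or dropped at will. *)
Lemma energyE w p N :
  \sum_i \sum_i' w i * w i' * \prod_j fejer N ((p i - p i') 0 j) =
  \sum_f ft2 w p (@diff_freq K d N f).
Proof.
under [RHS]eq_bigr do rewrite ft2E.
rewrite [RHS]exchange_big /=; apply: eq_bigr => i _.
rewrite [RHS]exchange_big /=; apply: eq_bigr => i' _.
by rewrite prod_fejer mulr_sumr.
Qed.

Lemma ft2_le1 w p xi : (forall i, 0 <= w i) -> \sum_i w i = 1 -> ft2 w p xi <= 1.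
Proof.
move=> w0 w1; rewrite ft2E.
apply: (@le_trans _ _ (\sum_i \sum_i' w i * w i')).
  apply: ler_sum => i _; apply: ler_sum => i' _.
  by rewrite -[leRHS]mulr1 ler_wpM2l ?mulr_ge0// cos_le1.
by under eq_bigr do rewrite -mulr_sumr w1 mulr1; rewrite w1.
Qed.

End Spectral.

Lemma ft2_conv {K : realType} {d : nat} {I J : finType} (w : I -> K) (v : J -> K)
    (p : I -> 'rV[K]_d) (q : J -> 'rV[K]_d) xi :
  ft2 (fun k : I * J => w k.1 * v k.2) (fun k => p k.1 + q k.2) xi =
  ft2 w p xi * ft2 v q xi.
Proof.
rewrite /ft2 -(pair_bigA _ (fun i j => w i * v j * cos (2 * pi * dotp (p i + q j) xi))) /=.
rewrite -(pair_bigA _ (fun i j => w i * v j * sin (2 * pi * dotp (p i + q j) xi))) /=.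
set C := \sum_i w i * cos _; set S := \sum_i w i * sin _.
set C' := \sum_i v i * cos _; set S' := \sum_i v i * sin _.
have -> : \sum_i \sum_j w i * v j * cos (2 * pi * dotp (p i + q j) xi) =
    C * C' - S * S'.
  rewrite !big_distrlr -sumrB; apply: eq_bigr => i _ /=.
  by rewrite -sumrB; apply: eq_bigr => j _; rewrite dotpDl mulrDr cosD; ring.
have -> : \sum_i \sum_j w i * v j * sin (2 * pi * dotp (p i + q j) xi) =
    S * C' + C * S'.
  rewrite !big_distrlr -big_split; apply: eq_bigr => i _ /=.
  by rewrite -big_split; apply: eq_bigr => j _; rewrite /= dotpDl mulrDr sinD; ring.
by ring.
Qed.

(** * Lattice sums of the Fejér majorant *)

Section KernelSums.
Context {K : realType}.

(* [v / (1 + |v|)] is a bounded increasing function whose unit increments dominate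
   [(1 + |v|)^-2] up to a constant. *)
Lemma inv_sqr_telescope (v : K) : (1 + `|v|) ^- 2 <=
  2 * ((v + 1) / (1 + `|v + 1|) - v / (1 + `|v|)).
Proof.
have [v0|v0] := leP 0 v.
  rewrite !ger0_norm; [|lra|lra].
  have -> : 2 * ((v + 1) / (1 + (v + 1)) - v / (1 + v)) =
      2 / ((1 + (v + 1)) * (1 + v)) by field; apply/andP; split; lra.
  rewrite -div1r ler_pdivrMr ?exprn_gt0//; last by lra.
  by rewrite mulrAC ler_pdivlMr; nra.
have [v1|v1] := leP (v + 1) 0.
  rewrite !ler0_norm; [|lra|lra].
  have -> : 2 * ((v + 1) / (1 + - (v + 1)) - v / (1 + - v)) =
      2 / ((- v) * (1 - v)) by field; apply/andP; split; lra.
  rewrite -div1r ler_pdivrMr ?exprn_gt0//; last by lra.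
  by rewrite mulrAC ler_pdivlMr; nra.
rewrite (ltr0_norm v0) (gtr0_norm v1).
have h1 : (v + 1) / 2 <= (v + 1) / (1 + (v + 1)).
  by rewrite ler_pM2l// lef_pV2 ?posrE; lra.
have h2 : (- v) / 2 <= (- v) / (1 + - v).
  by rewrite ler_pM2l ?lef_pV2 ?posrE; lra.
have : (1 + - v) ^- 2 <= 1 by rewrite invf_le1 ?exprn_gt0//; nra.
lra.
Qed.

(** The telescoped sum is a difference of two values of [h], which lie in [-1, 1]; hence a bound
    uniform in [x] and [W]. *)
Lemma sum_inv_sqr_le W (x : K) : \sum_(m < W) (1 + `|x - m%:R|) ^- 2 <= 4.
Proof.
pose h (m : nat) := (m%:R - x) / (1 + `|m%:R - x|).
have h1 m : `|h m| <= 1.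
  rewrite /h normrM normfV (@ger0_norm _ (1 + _)) ?addr_ge0//.
  by rewrite ler_pdivrMr ?mul1r ?ltr_pwDl// lerDr.
apply: (@le_trans _ _ (2 * \sum_(m < W) (h m.+1 - h m))).
  rewrite mulr_sumr; apply: ler_sum => m _; rewrite distrC.
  apply: le_trans (inv_sqr_telescope _) _.
  by rewrite /h (_ : m.+1%:R - x = m%:R - x + 1)// -[in LHS]natr1 addrAC.
rewrite -(big_mkord xpredT (fun m => h m.+1 - h m)) telescope_sumr//.
have := h1 W; have := h1 0; rewrite !ler_norml => /andP[a b] /andP[c e]; lra.
Qed.

(** Grouping by code bounds the mass attached to each product by [mu]; the sum over all codes of the
    products then factors over the coordinates. *)
Lemma sum_group_le {d W : nat} (I : finType) (b : I -> K)
    (code : I -> {ffun 'I_d -> 'I_W}) (psi : 'I_d -> 'I_W -> K) mu :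
  (forall j m, 0 <= psi j m) ->
  (forall c, \sum_(i | code i == c) b i <= mu) ->
  \sum_i b i * \prod_j psi j (code i j) <= mu * \prod_j \sum_m psi j m.
Proof.
move=> psi0 bmu; rewrite (partition_big code xpredT)//=.
rewrite bigA_distr_bigA mulr_sumr; apply: ler_sum => c _.
rewrite (eq_bigr (fun i => b i * \prod_j psi j (c j))); last by move=> i /eqP ->.
by rewrite -mulr_suml ler_wpM2r// prodr_ge0.
Qed.

End KernelSums.

(** * Dyadic cells *)

Section Cells.
Context {K : realType} {d : nat}.

(* Dyadic cube of side [2^-i]; the shift by [D] makes all coordinates of
   points of [-D, D)^d nonnegative, where [truncn] is the floor. *)
Definition cell (D i : nat) (y : 'rV[K]_d) : {ffun 'I_d -> nat} :=
  [ffun j => Num.truncn (2 ^+ i * (y 0 j + D%:R))].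

Definition in_cube (D : nat) (y : 'rV[K]_d) := forall j, - D%:R <= y 0 j < D%:R.

Lemma cellP D i y j : in_cube D y ->
  (cell D i y j)%:R <= 2 ^+ i * (y 0 j + D%:R) < (cell D i y j).+1%:R.
Proof.
move=> /(_ j) /andP[y1 y2]; rewrite ffunE truncn_itv// mulr_ge0 ?exprn_ge0//.
by rewrite -lerBlDr sub0r.
Qed.

Lemma cell_lt D i y j : in_cube D y -> (cell D i y j < 2 * D * 2 ^ i)%N.
Proof.
move=> yD; have /andP[h _] := cellP i j yD.
rewrite -(ltr_nat K); apply: le_lt_trans h _.
rewrite natrM natrX mulrC ltr_pM2r ?exprn_gt0//.
by have /andP[_ ?] := yD j; rewrite natrM; lra.
Qed.

(** The bound depends on [y] only through its cell, which is what allows grouping. Moving [y] within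
    a cell of side [2^-i >= 1/N] changes [1 + N |v|] by a bounded factor. The integer nearest to
    [x - y] depends on [y], so all candidates are summed. *)
Lemma fejer_cell_le (D i N : nat) (x y : 'rV[K]_d) j :
  (2 ^ i <= N)%N -> in_cube D x -> in_cube D y ->
  fejer N ((x - y) 0 j) <=
  \sum_(z < (4 * D).+1) 32 * N%:R ^+ 2 *
    (1 + `|2 ^+ i * (x 0 j + 3 * D%:R - z%:R) - (cell D i y j)%:R|) ^- 2.
Proof.
move=> iN xD yD; set m := cell D i y j.
have /andP[x1 x2] := xD j; have /andP[y1 y2] := yD j.
have /andP[m1 m2] := cellP i j yD; rewrite -/m in m1 m2.
(* The nearest integer to [x - y], shifted by [2 D] to be a natural number; it takes at most
   [4 D + 1] values. *)
pose z := Num.truncn (x 0 j - y 0 j + 2 * D%:R + 1 / 2).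
have /andP[z1 z2] : z%:R <= x 0 j - y 0 j + 2 * D%:R + 1 / 2 < z.+1%:R.
  by rewrite truncn_itv//; lra.
have zD : (z < (4 * D).+1)%N.
  rewrite -(ltr_nat K) -[X in _ < X]natr1 natrM; lra.
rewrite (bigD1 (Ordinal zD))//=; apply: ler_wpDr.
  apply: sumr_ge0 => k _.
  by rewrite !mulr_ge0 ?exprn_ge0 ?invr_ge0 ?exprn_ge0 ?addr_ge0.
pose v := x 0 j - y 0 j + 2 * D%:R - z%:R.
have -> : fejer N ((x - y) 0 j) = fejer N v.
  rewrite -(fejerD N _ (2 * D)) -[RHS](fejerD N _ z); congr fejer.
  by rewrite /v !mxE natrM; ring.
have hv : `|v| <= 1 / 2.
  by rewrite ler_norml; rewrite /v; move: z2; rewrite -[z.+1%:R]natr1 => z2; apply/andP; split; lra.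
apply: le_trans (fejer_decay _ hv) _.
set X := 2 ^+ i * _; set Y := (1 + `|X - _|) ^- 2.
have -> : 32 * N%:R ^+ 2 * Y = 8 * N%:R ^+ 2 * (4 * Y) by ring.
rewrite ler_wpM2l ?mulr_ge0 ?exprn_ge0// /Y.
have v0 := normr_ge0 v; have Xm0 := normr_ge0 (X - m%:R).
have i0 : 0 < 2 ^+ i :> K by rewrite exprn_gt0.
have h1 : 1 + `|X - m%:R| <= 2 * (1 + N%:R * `|v|).
  have -> : X - m%:R = 2 ^+ i * v + (2 ^+ i * (y 0 j + D%:R) - m%:R).
    by rewrite /X /v; ring.
  have th : `|2 ^+ i * (y 0 j + D%:R) - m%:R| <= 1.
    by rewrite ler_norml; move: m2; rewrite -[m.+1%:R]natr1 => m2; apply/andP; split; lra.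
  have := ler_normD (2 ^+ i * v) (2 ^+ i * (y 0 j + D%:R) - m%:R).
  rewrite normrM (gtr0_norm i0).
  have : 2 ^+ i * `|v| <= N%:R * `|v|.
    by rewrite ler_wpM2r// -natrX ler_nat.
  have : 0 <= N%:R * `|v| by rewrite mulr_ge0.
  lra.
have p1 : 0 < 1 + `|X - m%:R| by lra.
have p2 : 0 < 1 + N%:R * `|v| by lra.
have : (1 + `|X - m%:R|) ^+ 2 <= 4 * (1 + N%:R * `|v|) ^+ 2.
  have -> : 4 * (1 + N%:R * `|v|) ^+ 2 = (2 * (1 + N%:R * `|v|)) ^+ 2 by ring.
  by rewrite lerXn2r ?nnegrE//; lra.
move=> h2.
rewrite -[_ ^- 2]div1r ler_pdivrMr ?exprn_gt0// mulrAC ler_pdivlMr ?exprn_gt0//.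
by rewrite mul1r.
Qed.

End Cells.

(** * Energies and cell masses *)

Section Energy.
Context {K : realType} {d : nat}.

Definition weights (I : finType) (w : I -> K) :=
  (forall i, 0 <= w i) /\ \sum_i w i = 1.

(** For a fixed point [q a], the kernel is replaced by its majorant on cells. Each coordinate then
    contributes [4 D + 1] lattice sums, each at most [32 N^2] times 4; averaging over [a] costs
    nothing as the total mass is 1. *)
Lemma cell_energy_le (D i N : nat) (J : finType) (v : J -> K) (q : J -> 'rV[K]_d) mu :
  weights v -> (forall b, in_cube D (q b)) -> (2 ^ i <= N)%N ->
  (forall c, \sum_(b | cell D i (q b) == c) v b <= mu) ->
  \sum_f ft2 v q (@diff_freq K d N f) <=
  mu * (128 * (4 * D).+1%:R * N%:R ^+ 2) ^+ d.
Proof.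
move=> [v0 v1] qD iN mass.
rewrite -energyE.
suff H a : \sum_b v b * \prod_j fejer N ((q a - q b) 0 j) <=
    mu * (128 * (4 * D).+1%:R * N%:R ^+ 2) ^+ d.
  rewrite -[leRHS]mul1r -[X in X * (mu * _)]v1 mulr_suml.
  apply: ler_sum => a _.
  under eq_bigr do rewrite -mulrA.
  by rewrite -mulr_sumr ler_wpM2l.
pose W := (2 * D * 2 ^ i)%N.
pose psi j (m : 'I_W.+1) := \sum_(z < (4 * D).+1) 32 * N%:R ^+ 2 *
    (1 + `|2 ^+ i * (q a 0 j + 3 * D%:R - z%:R) - m%:R|) ^- 2.
pose code b : {ffun 'I_d -> 'I_W.+1} := [ffun j => inord (cell D i (q b) j)].
have codeE b j : code b j = cell D i (q b) j :> nat.
  by rewrite /code ffunE inordK// ltnS ltnW// cell_lt.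
have psi0 j m : 0 <= psi j m.
  apply: sumr_ge0 => z _.
  by rewrite !mulr_ge0 ?exprn_ge0 ?invr_ge0 ?exprn_ge0 ?addr_ge0.
have mass' c : \sum_(b | code b == c) v b <= mu.
  rewrite (eq_bigl (fun b => cell D i (q b) == [ffun j => c j : nat])).
    exact: mass.
  move=> b; apply/eqP/eqP => [<-|e]; apply/ffunP => j.
    by rewrite [RHS]ffunE codeE.
  by apply/val_inj; rewrite /= codeE e [LHS]ffunE.
have mu0 : 0 <= mu by apply: le_trans (mass [ffun => 0%N]); exact: sumr_ge0.
apply: (@le_trans _ _ (\sum_b v b * \prod_j psi j (code b j))).
  apply: ler_sum => b _; rewrite ler_wpM2l//.
  apply: ler_prod => j _; rewrite fejer_ge0/=.
  by apply: le_trans (fejer_cell_le j iN (qD a) (qD b)) _; rewrite /psi codeE.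
apply: le_trans (sum_group_le psi0 mass') _.
rewrite ler_wpM2l// -[X in _ <= _ ^+ X](card_ord d) -prodr_const.
apply: ler_prod => j _; rewrite sumr_ge0//= /psi exchange_big /=.
apply: (@le_trans _ _ (\sum_(z < (4 * D).+1) 32 * N%:R ^+ 2 * 4)).
  apply: ler_sum => z _; rewrite -mulr_sumr ler_wpM2l ?mulr_ge0 ?exprn_ge0//.
  exact: sum_inv_sqr_le.
rewrite sumr_const card_ord -mulr_natl; lra.
Qed.

(* Writing each frequency in the box of size [M] as a difference in many ways
   bounds the sharp cutoff sum by a Fejér energy at length [3 M + 1]. *)
Lemma cell_freq_le (D i : nat) (J : finType) (v : J -> K) (q : J -> 'rV[K]_d) mu :
  weights v -> (forall b, in_cube D (q b)) ->
  (forall c, \sum_(b | cell D i (q b) == c) v b <= mu) ->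
  \sum_k ft2 v q (@box_freq K d (2 ^ i) k) <=
  mu * (2048 * (4 * D).+1%:R) ^+ d * (2 ^+ d) ^+ i.
Proof.
move=> wv qD mass; set S := \sum_k _.
have mu0 : 0 <= mu.
  by apply: le_trans (mass [ffun => 0%N]); apply: sumr_ge0 => *; exact: wv.1.
have p0 : (0 < 2 ^ i)%N by rewrite expn_gt0.
have /= := sum_box_freq_le (2 ^ i) (ft2_ge0 v q).
rewrite -/S; move EM : (2 ^ i)%N => M in S p0 * => H.
have S0 : 0 <= S by apply: sumr_ge0 => *; exact: ft2_ge0.
have MN : (2 ^ i <= (3 * M).+1)%N by rewrite EM; lia.
have {}H := le_trans H (cell_energy_le wv qD MN mass).
have M0 : 0 < M%:R :> K by rewrite ltr0n.
have Md : 0 < M%:R ^+ d :> K by rewrite exprn_gt0.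
rewrite -(ler_pM2l Md).
apply: (@le_trans _ _ (M.+1%:R ^+ d * S)).
  by rewrite ler_wpM2r// lerXn2r ?nnegrE// ler_nat.
apply: le_trans H _.
have -> : (2 ^+ d) ^+ i = M%:R ^+ d :> K by rewrite -EM natrX exprAC.
have -> : M%:R ^+ d * (mu * (2048 * (4 * D).+1%:R) ^+ d * M%:R ^+ d) =
    mu * (2048 * (4 * D).+1%:R * M%:R ^+ 2) ^+ d :> K.
  have e : (M%:R ^+ 2) ^+ d = M%:R ^+ d * M%:R ^+ d :> K by rewrite exprAC expr2.
  by rewrite [in RHS]exprMn e; ring.
apply: ler_wpM2l; first exact: mu0.
apply: lerXn2r; rewrite ?nnegrE.
- by apply: mulr_ge0; [apply: mulr_ge0; exact: ler0n|exact: sqr_ge0].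
- by apply: mulr_ge0; [apply: mulr_ge0; exact: ler0n|exact: sqr_ge0].
have : ((3 * M).+1%:R : K) <= 4 * M%:R by rewrite -natrM ler_nat; lia.
have : 0 <= ((4 * D).+1%:R : K) by [].
have : 0 <= ((3 * M).+1%:R : K) by [].
set x := (4 * D).+1%:R; set y := (3 * M).+1%:R => y0 x0 xy.
(* Origin of 2048: the constant 128 of [cell_energy_le] times this 16. *)
have : y ^+ 2 <= 16 * M%:R ^+ 2 by nra.
nra.
Qed.

(** The factor 16 is the 8 of [fejer_ge] doubled, because the kernel used at scale [j] has length
    [2^j + 1 <= 2 * 2^j]. *)
Definition near_pair (j : nat) (x y : 'rV[K]_d) :=
  [forall k, `|(x - y) 0 k| * (16 * 2 ^+ j) <= 1].

(** With [N = 2^j + 1], each near pair has kernel value at least [(N^2 / 2)^d] and the other pairs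
    are nonnegative, whereas the whole energy is at most [N^d] times the sum over the box. *)
Lemma near_energy_le (j : nat) (I : finType) (w : I -> K) (p : I -> 'rV[K]_d) :
  weights w ->
  \sum_i \sum_(i' | near_pair j (p i) (p i')) w i * w i' <=
  2 ^+ d * (2 ^+ d) ^- j * \sum_k ft2 w p (@box_freq K d (2 ^ j) k).
Proof.
move=> [w0 w1]; set S := (X in _ <= _ * X).
have S0 : 0 <= S by apply: sumr_ge0 => *; exact: ft2_ge0.
have p0 : (0 < 2 ^ j)%N by rewrite expn_gt0.
have /= := sum_diff_freq_le (2 ^ j) (ft2_ge0 w p).
rewrite -/S -energyE.
have EM : (2 ^ j)%:R = 2 ^+ j :> K by rewrite natrX.
move: EM p0 @S S0; move: (2 ^ j)%N => M EM p0 S S0 H.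
set E := \sum_i _.
have M0 : 0 < M%:R :> K by rewrite ltr0n.
have N0 : 0 < M.+1%:R :> K by rewrite ltr0n.
have {}H : (M.+1%:R ^+ 2 / 2) ^+ d * E <= M.+1%:R ^+ d * S.
  apply: le_trans H; rewrite /E mulr_sumr; apply: ler_sum => i _.
  rewrite mulr_sumr big_mkcond; apply: ler_sum => i' _ /=.
  have F0 : 0 <= \prod_j0 fejer M.+1 ((p i - p i') 0 j0).
    by apply: prodr_ge0 => *; exact: fejer_ge0.
  case: ifP => [/forallP near|_]; last by rewrite !mulr_ge0.
  rewrite mulrC ler_wpM2l ?mulr_ge0//.
  rewrite -[X in _ ^+ X](card_ord d) -prodr_const.
  apply: ler_prod => k _; rewrite divr_ge0 ?exprn_ge0//=.
  apply: fejer_ge; apply: le_trans (near k).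
  rewrite ler_wpM2l// -EM.
  have : M.+1%:R <= 2 * M%:R :> K by rewrite -natrM ler_nat; lia.
  lra.
have Nd : 0 < M.+1%:R ^+ d :> K by rewrite exprn_gt0.
have {}H : M.+1%:R ^+ d * E <= 2 ^+ d * S.
  rewrite -(ler_pM2l Nd) (le_trans _ (_ : 2 ^+ d * (M.+1%:R ^+ d * S) <= _))//.
    rewrite -(ler_pM2l (_ : 0 < 2 ^- d)) ?invr_gt0 ?exprn_gt0//.
    rewrite [leRHS]mulrA mulVf ?expf_neq0// mul1r.
    apply: le_trans H; rewrite exprMn exprVn -exprM mulnC exprM expr2.
    by rewrite le_eqVlt; apply/orP; left; apply/eqP; ring.
  by rewrite le_eqVlt; apply/orP; left; apply/eqP; ring.
have E0 : 0 <= E by do 2![apply: sumr_ge0 => ? _]; rewrite mulr_ge0.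
have Md : 0 < (2 ^+ d) ^+ j :> K by rewrite !exprn_gt0.
rewrite mulrAC ler_pdivlMr//.
apply: le_trans H; rewrite mulrC ler_wpM2r// -exprM mulnC exprM -EM.
by rewrite lerXn2r ?nnegrE// ler_nat.
Qed.

End Energy.

(** * Energy of a convolution *)

Section ConvolutionEnergy.
Context {K : realType} {d : nat}.

Lemma geometric_recursion (S : nat -> K) n (q c s0 : K) : q != 1 ->
  S 0 <= s0 -> (forall i, (i < n)%N -> S i.+1 <= S i + c * q ^+ i) ->
  forall j, (j <= n)%N -> S j <= s0 + c * ((q ^+ j - 1) / (q - 1)).
Proof.
move=> q1 S0 H; elim=> [_|j IH jn]; first by rewrite expr0 subrr mul0r mulr0 addr0.
apply: le_trans (H j jn) _; have := IH (ltnW jn).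
have q1' : q - 1 != 0 by rewrite subr_eq0.
have -> : (q ^+ j.+1 - 1) / (q - 1) = (q ^+ j - 1) / (q - 1) + q ^+ j.
  by rewrite exprS; field.
rewrite mulrDr; lra.
Qed.

Lemma weights_conv (I J : finType) (w : I -> K) (v : J -> K) :
  weights w -> weights v -> weights (fun k : I * J => w k.1 * v k.2).
Proof.
move=> [w0 w1] [v0 v1]; split=> [k|]; first by rewrite mulr_ge0.
rewrite -(pair_bigA _ (fun i j => w i * v j)) /=.
by under eq_bigr do rewrite -mulr_sumr v1 mulr1.
Qed.

(** Here [a = 2^-s], [b = 2^-t], and [r = 2^d a b] is the ratio between consecutive shells. If
    [r > 1] the last shell dominates and [2^(-jd) r^j = (a b)^j]; if [r < 1] the series converges
    and only [2^(-jd)] remains. *)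
Lemma conv_energy_le (D : nat) (a b ca cb e : K) :
  0 < a -> 0 < b -> 0 <= ca -> 0 <= cb ->
  (1 < 2 ^+ d * a * b /\ e = a * b) \/ (2 ^+ d * a * b < 1 /\ e = 2 ^- d) ->
  exists2 C, 0 < C & forall n (I J : finType) (w : I -> K) (v : J -> K)
    (p : I -> 'rV[K]_d) (q : J -> 'rV[K]_d),
  weights w -> weights v -> (forall i, in_cube D (q i)) ->
  (forall i (xi : 'rV[K]_d), (i < n)%N -> (exists k, (2 ^ i)%:R < `|xi 0 k|) ->
    (forall k, `|xi 0 k| <= (2 ^ i.+1)%:R) -> ft2 w p xi <= ca * a ^+ i) ->
  (forall i c, (i <= n)%N -> \sum_(k | cell D i (q k) == c) v k <= cb * b ^+ i) ->
  forall j, (j <= n)%N ->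
  \sum_(k : I * J) \sum_(k' : I * J | near_pair j (p k.1 + q k.2) (p k'.1 + q k'.2))
    (w k.1 * v k.2) * (w k'.1 * v k'.2) <= C * e ^+ j.
Proof.
move=> a0 b0 ca0 cb0 he.
pose r := 2 ^+ d * a * b.
have r0 : 0 < r by rewrite !mulr_gt0 ?exprn_gt0.
pose m := (2048 * (4 * D).+1%:R) ^+ d : K.
have m0 : 0 <= m by apply: exprn_ge0; apply: mulr_ge0; exact: ler0n.
have freq_le i (J : finType) (v : J -> K) q mu : weights v ->
    (forall k, in_cube D (q k)) ->
    (forall c, \sum_(k | cell D i (q k) == c) v k <= mu) ->
    \sum_k ft2 v q (@box_freq K d (2 ^ i) k) <= mu * m * (2 ^+ d) ^+ i.
  exact: cell_freq_le.
move: m m0 freq_le => m m0 freq_le.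
pose c := ca * (cb * m * (2 ^+ d * b)).
have c0 : 0 <= c by rewrite !mulr_ge0 ?exprn_ge0// ltW.
pose C := 2 ^+ d * (3%:R ^+ d + c / `|r - 1|).
have r1 : r != 1 by case: he => -[h _]; rewrite neq_lt h ?orbT.
have C0 : 0 < C.
  by rewrite mulr_gt0 ?exprn_gt0// ltr_pwDl ?exprn_gt0// divr_ge0.
exists C => // n I J w v p q ww wv qD hw hv j jn.
pose W (k : I * J) := w k.1 * v k.2.
pose P (k : I * J) := p k.1 + q k.2.
have wW : weights W by exact: weights_conv.
apply: le_trans (near_energy_le j P wW) _.
pose S i := \sum_k ft2 W P (@box_freq K d (2 ^ i) k).
(* The [3^d] frequencies of [-1, 1]^d contribute at most 1 each. *)
have S0 : S 0 <= 3%:R ^+ d.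
  rewrite /S; apply: (@le_trans _ _ (\sum_(k : {ffun 'I_d -> 'I_(2 * 2 ^ 0).+1}) 1)).
    by apply: ler_sum => k _; apply: ft2_le1; [exact: wW.1|exact: wW.2].
  by rewrite sumr_const card_ffun !card_ord -natrX.
have SS i : (i < n)%N -> S i.+1 <= S i + c * r ^+ i.
  move=> iN; rewrite /S expnS.
  under eq_bigr do rewrite ft2_conv.
  under [X in _ <= X + _]eq_bigr do rewrite ft2_conv.
  apply: le_trans (@sum_box_freq_split K d (2 ^ i) _ _ (ca * a ^+ i) _ _ _ _) _.
  - exact: ft2_ge0.
  - exact: ft2_ge0.
  - by rewrite mulr_ge0// exprn_ge0 ?ltW.
  - by move=> x h1 h2; apply: hw => // k; rewrite expnS.
  rewrite lerD2l -expnS.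
  have h := freq_le _ _ _ _ _ wv qD (hv i.+1 ^~ iN).
  apply: (@le_trans _ _ (ca * a ^+ i * (cb * b ^+ i.+1 * m * (2 ^+ d) ^+ i.+1))).
    by rewrite ler_wpM2l// mulr_ge0// exprn_ge0 ?ltW.
  by rewrite le_eqVlt /c /r !exprMn !exprS; apply/orP; left; apply/eqP; ring.
have := geometric_recursion r1 S0 SS jn; rewrite -/(S j) => hS.
have d0 : 0 < 2 ^+ d :> K by rewrite exprn_gt0.
apply: (@le_trans _ _ (2 ^+ d * (2 ^+ d) ^- j * (3 ^+ d + c * ((r ^+ j - 1) / (r - 1))))).
  by rewrite ler_wpM2l// mulr_ge0 ?invr_ge0 ?exprn_ge0// ltW.
have b3 : 0 <= 3 ^+ d :> K by rewrite exprn_ge0.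
case: he => -[]; rewrite -/r => hr ->.
  have -> : a * b = (2 ^+ d)^-1 * r by rewrite /r; field; rewrite gt_eqF.
  rewrite [X in _ <= _ * X]exprMn exprVn /C gtr0_norm ?subr_gt0//.
  have rj : 1 <= r ^+ j by rewrite exprn_ege1// ltW.
  have -> : forall X, 2 ^+ d * X * ((2 ^+ d) ^- j * r ^+ j) = 2 ^+ d * (2 ^+ d) ^- j * (X * r ^+ j).
    by move=> X; ring.
  rewrite ler_wpM2l//.
  rewrite [leRHS]mulrDl lerD//; first by rewrite ler_peMr.
  rewrite -[leRHS]mulrA; apply: ler_wpM2l => //; rewrite mulrC.
  apply: ler_wpM2l; rewrite ?invr_ge0; lra.
rewrite exprVn /C ltr0_norm ?subr_lt0// opprB mulrAC.
rewrite ler_wpM2r ?invr_ge0 ?exprn_ge0 ?(ltW d0)// ler_wpM2l ?(ltW d0)//.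
rewrite lerD2l ler_wpM2l// -[_ / (r - 1)]mulrNN -invrN !opprB.
rewrite -[leRHS]mul1r ler_wpM2r ?invr_ge0 ?subr_ge0 ?(ltW hr)//.
by rewrite lerBlDr lerDl exprn_ge0// ltW.
Qed.

End ConvolutionEnergy.

(** * Covers of a point set of small energy *)

Section Covering.
Context {K : realType}.

Lemma markov_half (I : finType) (w f : I -> K) c : weights w -> 0 < c ->
  (forall i, 0 <= f i) -> \sum_i w i * f i <= c ->
  1 / 2 <= \sum_(i | f i <= 2 * c) w i.
Proof.
move=> [w0 w1] c0 f0 fc.
have : 2 * c * \sum_(i | ~~ (f i <= 2 * c)) w i <= c.
  apply: le_trans fc; rewrite mulr_sumr.
  apply: (@le_trans _ _ (\sum_(i | ~~ (f i <= 2 * c)) w i * f i)).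
    by apply: ler_sum => i; rewrite -ltNge => /ltW h; rewrite mulrC ler_wpM2l.
  rewrite [leRHS](bigID (fun i => f i <= 2 * c)) /= lerDr sumr_ge0// => i _.
  exact: mulr_ge0.
move: w1; rewrite (bigID (fun i => f i <= 2 * c)) /=; nra.
Qed.

Lemma cover_mass_le (T : eqType) (s : seq T) (I : finType) (w : I -> K)
    (A : pred I) (B : T -> pred I) : (forall i, 0 <= w i) ->
  (forall i, A i -> exists2 k, k \in s & B k i) ->
  \sum_(i | A i) w i <= \sum_(k <- s) \sum_(i | A i && B k i) w i.
Proof.
move=> w0 H; under [leRHS]eq_bigr do rewrite big_mkcondr.
rewrite exchange_big /=; apply: ler_sum => i Ai.
have [k ks Bk] := H i Ai.
rewrite (big_rem k)//= Bk lerDl; apply: sumr_ge0 => l _.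
by case: ifP.
Qed.

Context {d : nat}.
Implicit Types (x y : 'rV[K]_d).

(** If all points of [A] are near each other, they all lie in the neighbourhood of any one of them;
    [0 <= m] serves the empty case. *)
Lemma near_mass_le (I : finType) (w : I -> K) (p : I -> 'rV[K]_d) (A : pred I) j m :
  (forall i, 0 <= w i) -> 0 <= m ->
  (forall i, A i -> \sum_(i' | near_pair j (p i) (p i')) w i' <= m) ->
  (forall i i', A i -> A i' -> near_pair j (p i) (p i')) ->
  \sum_(i | A i) w i <= m.
Proof.
move=> w0 m0 Am near.
have [i Ai|A0] := pickP A; last by rewrite big1// => i; rewrite A0.
apply: le_trans (Am _ Ai); rewrite big_mkcond [leRHS]big_mkcond /=.
apply: ler_sum => i' _; case: (boolP (A i')) => [Ai'|_]; first by rewrite near.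
by case: ifP.
Qed.

Lemma sum_indicator_le W (x : K) : 0 <= x -> \sum_(m < W) (m%:R <= x)%R%:R <= x + 1.
Proof.
move=> x0; elim: W => [|W IH]; first by rewrite big_ord0 addr_ge0.
rewrite big_ord_recr /=; have [h|h] := leP W%:R x; last by rewrite addr0.
rewrite lerD2r; apply: le_trans h.
apply: (@le_trans _ _ (\sum_(m < W) 1)); last by rewrite sumr_const card_ord.
by apply: ler_sum => m _; case: (m%:R <= x)%R.
Qed.

(** The box is cut into cells of side [2^-j / 16], whose points are pairwise near, so each cell has
    mass at most [m]. *)
Lemma box_mass_le (I : finType) (w : I -> K) (p : I -> 'rV[K]_d) (A : pred I) j m a b :
  (forall i, 0 <= w i) -> 0 <= m ->
  (forall i, A i -> \sum_(i' | near_pair j (p i) (p i')) w i' <= m) ->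
  (forall i, A i -> box a b (p i)) ->
  (forall k, 1 <= (b 0 k - a 0 k) * (16 * 2 ^+ j)) ->
  \sum_(i | A i) w i <= m * (32 * 2 ^+ j) ^+ d * \prod_k (b 0 k - a 0 k).
Proof.
move=> w0 m0 Am Abox side.
pose l k := (b 0 k - a 0 k) * (16 * 2 ^+ j).
have r0 : 0 < 16 * 2 ^+ j :> K by rewrite mulr_gt0 ?exprn_gt0.
pose W := (\max_(k < d) Num.truncn (l k))%N.
pose t i k := (p i 0 k - a 0 k) * (16 * 2 ^+ j).
have tl i k : A i -> 0 <= t i k <= l k.
  move=> /Abox /(_ k) /andP[h1 h2]; rewrite /t /l mulr_ge0 ?(ltW r0) ?subr_ge0//=.
  by rewrite ler_wpM2r ?(ltW r0)// lerB.
pose code i : {ffun 'I_d -> 'I_W.+1} := [ffun k => inord (Num.truncn (t i k))].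
have codeE i k : A i -> code i k = Num.truncn (t i k) :> nat.
  move=> Ai; rewrite /code ffunE inordK// ltnS; have /andP[h1 h2] := tl i k Ai.
  by apply: leq_trans (le_truncn h2) _; rewrite /W (leq_bigmax k).
pose psi k (m : 'I_W.+1) : K := (m%:R <= l k)%R%:R.
apply: (@le_trans _ _ (\sum_i (if A i then w i else 0) * \prod_k psi k (code i k))).
  rewrite big_mkcond; apply: ler_sum => i _; case: ifP => Ai; last by rewrite mul0r.
  rewrite big1 ?mulr1// => k _; rewrite /psi codeE//.
  have /andP[h1 h2] := tl i k Ai; rewrite (le_trans _ h2)//.
  by rewrite truncn_le.
apply: (@le_trans _ _ (m * \prod_k \sum_m psi k m)).
  apply: sum_group_le => [k n|c]; first by rewrite /psi ler0n.
  rewrite -big_mkcondr /=.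
  apply: (near_mass_le w0 m0 (j := j) (p := p)).
    by move=> i /andP[_ Ai]; exact: Am.
  move=> i i' /andP[/eqP ci Ai] /andP[/eqP ci' Ai']; apply/forallP => k.
  have e : Num.truncn (t i k) = Num.truncn (t i' k) by rewrite -!codeE// ci ci'.
  have /andP[s1 _] := tl i k Ai; have /andP[s2 _] := tl i' k Ai'.
  have /andP[] := truncn_itv s1; have /andP[] := truncn_itv s2.
  rewrite e -[_.+1%:R]natr1 => a1 a2 b1 b2.
  rewrite -(gtr0_norm r0) -normrM !mxE.
  have -> : (p i 0 k - p i' 0 k) * (16 * 2 ^+ j) = t i k - t i' k by rewrite /t; ring.
  by rewrite ler_norml; apply/andP; split; lra.
rewrite -mulrA ler_wpM2l// -[X in _ ^+ X](card_ord d) -prodr_const -big_split /=.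
apply: ler_prod => k _; rewrite sumr_ge0 /psi => [|n _]; last by rewrite ler0n.
have lk : 1 <= l k by exact: side.
(* At most [l + 1 <= 2 l] cells along each side, as [l >= 1]; this doubling turns 16 into 32. *)
apply: le_trans (sum_indicator_le _ _) _; first lra.
have -> : 32 * 2 ^+ j * (b 0 k - a 0 k) = l k + l k by rewrite /l; ring.
lra.
Qed.

(** Markov's inequality at the single scale [n]: points of total mass at least 1/2 have
    neighbourhood mass at most [2 C 2^(-dn)], so a box holds an amount of such points proportional
    to its volume. *)
Lemma volume_ge (T : eqType) (s : seq T) (I : finType) (w : I -> K)
    (p : I -> 'rV[K]_d) (n : nat) (C : K) (a b : T -> 'rV[K]_d) :
  weights w -> 0 < C ->
  \sum_i \sum_(i' | near_pair n (p i) (p i')) w i * w i' <= C * 2 ^- d ^+ n ->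
  (forall i, exists2 k, k \in s & box (a k) (b k) (p i)) ->
  (forall k j, k \in s -> 1 <= (b k 0 j - a k 0 j) * (16 * 2 ^+ n)) ->
  1 / 2 <= 2 * C * 32 ^+ d * \sum_(k <- s) \prod_j (b k 0 j - a k 0 j).
Proof.
move=> ww C0 En cov side.
pose f i := \sum_(i' | near_pair n (p i) (p i')) w i'.
pose c := C * 2 ^- d ^+ n.
have c0 : 0 < c by rewrite mulr_gt0 ?exprn_gt0 ?invr_gt0 ?exprn_gt0.
have f0 i : 0 <= f i by apply: sumr_ge0 => *; exact: ww.1.
have := markov_half ww c0 f0.
have -> : \sum_i w i * f i =
    \sum_i \sum_(i' | near_pair n (p i) (p i')) w i * w i'.
  by apply: eq_bigr => i _; rewrite mulr_sumr.
move=> /(_ En) h; apply: le_trans h _.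
apply: le_trans (cover_mass_le (s := s) (B := fun k i => `[< box (a k) (b k) (p i) >]) ww.1 _) _.
  by move=> i _; have [k ks h] := cov i; exists k => //; apply/asboolP.
rewrite mulr_sumr !big_seq; apply: ler_sum => k ks.
apply: le_trans (box_mass_le (j := n) (m := 2 * c) (p := p) (a := a k) (b := b k) ww.1 _ _ _ _) _.
- by rewrite mulr_ge0// ltW.
- by move=> i /andP[].
- by move=> i /andP[_ /asboolP].
- by move=> j; exact: side.
rewrite ler_wpM2r//.
  apply: prodr_ge0 => j _; have := side k j ks.
  have : 0 < 16 * 2 ^+ n :> K by rewrite mulr_gt0 ?exprn_gt0.
  by move=> r0 h; rewrite -(pmulr_lge0 _ r0) (le_trans _ h).
rewrite /c exprMn (exprAC _ n d) exprVn le_eqVlt; apply/orP; left; apply/eqP.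
have : (2 ^+ d) ^+ n != 0 :> K by rewrite !expf_neq0.
by set z := (2 ^+ d) ^+ n => z0; field.
Qed.

(** The function [f] is a discrete potential with weights [g^j], where [g = 2^u] in the application.
    Its average is at most the geometric series [C / (1 - g e)], so Markov's inequality yields
    points whose neighbourhood mass is at most [2 c g^-j] at all scales [j] simultaneously, whatever
    the level of the set that covers them. *)
Lemma content_ge (T : eqType) (s : seq T) (I : finType) (w : I -> K)
    (p : I -> 'rV[K]_d) (n : nat) (C e g : K) (ball : T -> pred I)
    (lev : T -> nat) (V : T -> K) :
  weights w -> 0 < C -> 0 < e -> 0 < g -> g * e < 1 ->
  (forall j, (j <= n)%N ->
    \sum_i \sum_(i' | near_pair j (p i) (p i')) w i * w i' <= C * e ^+ j) ->
  (forall i, exists2 k, k \in s & ball k i) ->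
  (forall k i i', k \in s -> ball k i -> ball k i' ->
    near_pair (lev k) (p i) (p i')) ->
  (forall k, k \in s -> (lev k <= n)%N /\ g ^- lev k <= V k) ->
  1 / 2 <= 2 * (C / (1 - g * e)) * \sum_(k <- s) V k.
Proof.
move=> ww C0 e0 g0 ge1 En cov nearb hV.
pose f i := \sum_(j < n.+1) g ^+ j * \sum_(i' | near_pair j (p i) (p i')) w i'.
pose c := C / (1 - g * e).
have c0 : 0 < c by rewrite divr_gt0// subr_gt0.
have m0 j i : 0 <= g ^+ j * \sum_(i' | near_pair j (p i) (p i')) w i'.
  by rewrite mulr_ge0 ?exprn_ge0 ?(ltW g0)//; apply: sumr_ge0 => *; exact: ww.1.
have f0 i : 0 <= f i by apply: sumr_ge0.
have fc : \sum_i w i * f i <= c.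
  have -> : \sum_i w i * f i = \sum_(j < n.+1) g ^+ j *
      \sum_i \sum_(i' | near_pair j (p i) (p i')) w i * w i'.
    under eq_bigr do rewrite mulr_sumr.
    rewrite exchange_big /=; apply: eq_bigr => j _; rewrite mulr_sumr.
    by apply: eq_bigr => i _; rewrite mulrCA mulr_sumr.
  apply: (@le_trans _ _ (\sum_(j < n.+1) C * (g * e) ^+ j)).
    apply: ler_sum => j _; rewrite exprMn mulrCA ler_wpM2l ?exprn_ge0 ?(ltW g0)//.
    by apply: En; rewrite -ltnS.
  rewrite -mulr_sumr ler_wpM2l ?(ltW C0)//.
  rewrite -[leRHS]mul1r ler_pdivlMr ?subr_gt0//.
  have := subrX1 (g * e) n.+1.
  have : 0 <= (g * e) ^+ n.+1 by rewrite exprn_ge0 ?mulr_ge0// ltW.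
  lra.
have h := markov_half ww c0 f0 fc; apply: le_trans h _.
apply: le_trans (cover_mass_le (s := s) (B := ball) ww.1 _) _.
  by move=> i _; exact: cov.
rewrite mulr_sumr !big_seq; apply: ler_sum => k ks.
have [kn kV] := hV k ks.
have gk : 0 < g ^+ lev k by rewrite exprn_gt0.
apply: (near_mass_le (j := lev k) (p := p)) => //.
- exact: ww.1.
- rewrite mulr_ge0// ?(le_trans _ kV)//; first by rewrite mulr_ge0// ltW.
  by rewrite invr_ge0 ltW.
- move=> i /andP[fi _].
  apply: (@le_trans _ _ (2 * c * g ^- lev k)); last first.
    by rewrite ler_wpM2l// mulr_ge0// ltW.
  rewrite ler_pdivlMr// mulrC; apply: le_trans fi.
  rewrite /f (bigD1 (Ordinal (kn : (lev k < n.+1)%N)))//= lerDl.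
  exact: sumr_ge0.
- by move=> i i' /andP[_ bi] /andP[_ bi']; exact: nearb.
Qed.

End Covering.

(** * A finite Frostman lemma *)

Section Tree.
Context {K : realType} (P : finType) (T : eqType) (q : nat -> P -> T) (b : K).
Context (act : pred P) (n : nat).
Hypothesis b0 : 0 < b.
Hypothesis refine1 : forall j p p', q j.+1 p = q j.+1 p' -> q j p = q j p'.
Hypothesis inj_act : forall p p', act p -> act p' -> q n p = q n p' -> p = p'.

Definition mass (w : P -> K) j p := \sum_(p' | q j p' == q j p) w p'.

Lemma refineW i j p p' : (j <= i)%N -> q i p = q i p' -> q j p = q j p'.
Proof.
move=> ji; rewrite -(subnKC ji); elim: (i - j)%N => [|k IH]; first by rewrite addn0.
by rewrite addnS => /refine1.
Qed.

(** The upper bounds are the Frostman condition; the last clause, a saturated class above each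
    active leaf, is what prevents the total mass from being too small. *)
Definition tree_weights (j0 : nat) (w : P -> K) :=
  [/\ forall p, 0 <= w p,
     forall j p, (j0 <= j <= n)%N -> mass w j p <= b ^+ j &
     forall p, act p -> exists2 j, (j0 <= j <= n)%N & mass w j p = b ^+ j].

(* Start from the weights [b ^+ n] on the leaves and go up the tree, scaling
   down the weights of every class whose mass is too large.  A class
   that is scaled becomes saturated, and the classes below it are the only
   ones whose saturation is lost. *)
Lemma exists_tree_weights j0 : (j0 <= n)%N -> exists w, tree_weights j0 w.
Proof.
move=> j0n; rewrite -(subKn j0n); move: (n - j0)%N (leq_subr j0 n) => k.
elim: k => [_|k IH kn].
  rewrite subn0; exists (fun p => if act p then b ^+ n else 0); split.
  - by move=> p; case: ifP => // _; rewrite exprn_ge0// ltW.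
  - move=> j p /andP[h1 h2]; have -> : j = n by apply/eqP; rewrite eqn_leq h1 h2.
    rewrite /mass -big_mkcondr.
    have [p1|A0] := pickP (fun p' => (q n p' == q n p) && act p').
      move=> /andP[/eqP e1 a1]; rewrite (bigD1 p1) ?e1 ?eqxx//= big1 ?addr0//.
      move=> p2 /andP[/andP[/eqP e2 a2]] /eqP; case.
      by apply: inj_act => //; rewrite e1.
    by rewrite big1 ?exprn_ge0 ?ltW// => p'; rewrite A0.
  - move=> p ap; exists n; first by rewrite leqnn.
    rewrite /mass -big_mkcondr (bigD1 p) ?eqxx//= big1 ?addr0//.
    move=> p2 /andP[/andP[/eqP e2 a2]] /eqP; case.
    exact: inj_act.
have [w [w0 wle wsat]] := IH (ltnW kn).
set j := (n - k.+1)%N.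
have jE : (n - k)%N = j.+1 by rewrite /j -subSn.
have bj : 0 < b ^+ j by rewrite exprn_gt0.
pose s p := if mass w j p <= b ^+ j then 1 else b ^+ j / mass w j p.
have s_class i p p' : (j <= i)%N -> q i p' = q i p -> s p' = s p.
  by move=> ji /(refineW ji) e; rewrite /s /mass e.
have s0 p : 0 <= s p.
  by rewrite /s; case: ifP => // _; rewrite divr_ge0 ?(ltW bj)//; exact: sumr_ge0.
have s1 p : s p <= 1.
  rewrite /s; case: (leP (mass w j p)) => // h; rewrite ler_pdivrMr ?mul1r ?(ltW h)//.
  exact: lt_trans h.
have massE i p : (j <= i)%N -> mass (fun p => s p * w p) i p = s p * mass w i p.
  move=> ji; rewrite /mass mulr_sumr; apply: eq_bigr => p' /eqP e.
  by rewrite (s_class i p p').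
exists (fun p => s p * w p); split.
- by move=> p; rewrite mulr_ge0.
- move=> i p /andP[ji iN]; rewrite massE//.
  move: ji; rewrite leq_eqVlt => /orP[/eqP <-|ji].
    rewrite /s; case: (leP (mass w j p)) => h; first by rewrite mul1r.
    by rewrite divfK// gt_eqF// (lt_trans bj).
  apply: le_trans (wle i p _); last by rewrite jE ji.
  by rewrite -[leRHS]mul1r ler_wpM2r//; exact: sumr_ge0.
- move=> p ap; case: (leP (mass w j p) (b ^+ j)) => h.
    have [i /andP[i1 i2] e] := wsat p ap; exists i.
      by rewrite i2 andbT ltnW// -jE.
    by rewrite massE ?e; [rewrite /s h mul1r|rewrite ltnW// -jE].
  exists j; first by rewrite leqnn leq_subr.
  by rewrite massE// /s leNgt h /= divfK// gt_eqF// (lt_trans bj).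
Qed.

Lemma sum_at_most_one (X : eqType) (s : seq X) (B : pred X) (c : K) : 0 <= c ->
  uniq s -> (forall x y, x \in s -> y \in s -> B x -> B y -> x = y) ->
  \sum_(x <- s | B x) c <= c.
Proof.
move=> c0; elim: s => [|x s IH] /=; first by rewrite big_nil.
move=> /andP[xs us] H; rewrite big_cons; case: ifP => Bx; last first.
  by apply: IH => // y z ys zs; apply: H; rewrite inE ?ys ?zs orbT.
rewrite big_seq_cond big1 ?addr0// => y /andP[ys By]; exfalso.
have e : x = y by apply: H => //; rewrite inE ?eqxx// ys orbT.
by rewrite e ys in xs.
Qed.

(* The maximal saturated classes are disjoint and cover all active leaves. *)
Lemma saturated_cover j0 w : tree_weights j0 w -> exists s : seq (nat * T),
  [/\ forall x, x \in s -> (j0 <= x.1 <= n)%N,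
     forall p, act p -> exists2 x, x \in s & q x.1 p = x.2 &
     \sum_(x <- s) b ^+ x.1 <= \sum_p w p].
Proof.
move=> [w0 wle wsat].
pose sat p j := (j0 <= j <= n)%N && (mass w j p == b ^+ j).
have exs p : exists j, act p ==> sat p j.
  case: (boolP (act p)) => ap; last by exists 0%N.
  by have [j h e] := wsat p ap; exists j; rewrite /sat h e eqxx.
(* The least saturated level is the largest saturated class. *)
pose lev p := ex_minn (exs p).
have levP p : act p -> sat p (lev p) /\ forall i, sat p i -> (lev p <= i)%N.
  by move=> ap; rewrite /lev; case: ex_minnP => j; rewrite ap.
pose s := undup [seq (lev p, q (lev p) p) | p <- enum act].
have sP x : x \in s -> exists2 p, act p & x = (lev p, q (lev p) p).
  by rewrite mem_undup => /mapP[p]; rewrite mem_enum; exists p.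
exists s; split.
- by move=> x /sP[p ap ->] /=; have [/andP[]] := levP p ap.
- move=> p ap; exists (lev p, q (lev p) p) => //.
  by rewrite mem_undup; apply/mapP; exists p => //; rewrite mem_enum.
have -> : \sum_(x <- s) b ^+ x.1 = \sum_(x <- s) \sum_(p | q x.1 p == x.2) w p.
  apply: eq_big_seq => x /sP[p ap ->] /=.
  by have [/andP[_ /eqP <-]] := levP p ap.
under eq_bigr do rewrite big_mkcond.
rewrite exchange_big /=; apply: ler_sum => p _; rewrite -big_mkcond.
apply: sum_at_most_one => //; first exact: undup_uniq.
(* If two selected classes share a leaf, the coarser one contains the finer one, so minimality of
   the finer level forces equality. *)
suff H x y : x \in s -> y \in s -> q x.1 p == x.2 -> q y.1 p == y.2 ->
    (x.1 <= y.1)%N -> x = y.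
  move=> x y xs ys Bx By; case/orP: (leq_total x.1 y.1) => h; first exact: H.
  by apply/esym; apply: H.
move=> /sP[p1 a1 ->] /sP[p2 a2 ->] /= /eqP e1 /eqP e2 le12.
have h : q (lev p1) p2 = q (lev p1) p1 by rewrite -e1 (refineW le12 e2).
have [/andP[r1 m1] _] := levP p1 a1.
have [_ /(_ (lev p1))] := levP p2 a2.
rewrite /sat r1 /mass h m1 => /(_ isT) le21.
have e : lev p1 = lev p2 by apply/eqP; rewrite eqn_leq le12 le21.
by rewrite -e h.
Qed.

End Tree.

(** * Diameters and finite covers *)

Section Metric.
Context {K : realType} {d : nat}.
Implicit Types (x y : 'rV[K]_d) (A B U : set 'rV[K]_d).

Lemma coord_le_enorm x j : `|x 0 j| <= enorm x.
Proof.
rewrite -sqrtr_sqr ler_wsqrtr// /dotp (bigD1 j)//= expr2 lerDl.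
by apply: sumr_ge0 => k _; rewrite -expr2 sqr_ge0.
Qed.

Lemma enorm_le x (r : K) : 0 <= r -> (forall j, `|x 0 j| <= r) -> enorm x <= d%:R * r.
Proof.
move=> r0 xr; have dr0 : 0 <= d%:R * r by rewrite mulr_ge0.
rewrite -(ger0_norm dr0) -sqrtr_sqr ler_wsqrtr//.
apply: (@le_trans _ _ (\sum_(j < d) r ^+ 2)).
  apply: ler_sum => j _; rewrite -expr2 -real_normK ?num_real//.
  by rewrite lerXn2r ?nnegrE.
rewrite sumr_const card_ord -[leLHS]mulr_natl exprMn ler_wpM2r ?sqr_ge0//.
by rewrite -natrX ler_nat; case: (d) => // n; rewrite leq_pmulr.
Qed.

Lemma diam_le U (r : K) :
  (forall x y, U x -> U y -> enorm (x - y) <= r) -> (diam U <= r%:E)%E.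
Proof.
by move=> H; apply: ge_ereal_sup => _ /= [[x y] [Ux Uy] <-]; rewrite lee_fin; exact: H.
Qed.

Lemma enorm_le_diam U x y : U x -> U y -> ((enorm (x - y))%:E <= diam U)%E.
Proof. by move=> Ux Uy; apply: ereal_sup_ubound; exists (x, y). Qed.

Lemma diam_ge0 U : U !=set0 -> (0 <= diam U)%E.
Proof.
by move=> [x Ux]; apply: le_trans (enorm_le_diam Ux Ux); rewrite lee_fin sqrtr_ge0.
Qed.

Lemma diam_pow_ge0 t U : (0 <= diam_pow t U)%E.
Proof. by rewrite /diam_pow; case: ifP => // _; exact: poweR_ge0. Qed.

Lemma diam_pow_le t U (r : K) : 0 <= t -> 0 <= r -> (diam U <= r%:E)%E ->
  (diam_pow t U <= (r `^ t)%:E)%E.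
Proof.
move=> t0 r0 h; rewrite /diam_pow; case: eqP => [_|/eqP/set0P/diam_ge0 h0].
  by rewrite lee_fin powR_ge0.
move: h h0; case: (diam U) => [z| |]//; rewrite !lee_fin => zr z0.
by rewrite ge0_ler_powR.
Qed.

(** The finite family is padded with empty sets, which have diameter [-oo] and contribute 0 even for
    exponent 0. *)
Lemma hausdorff_content_le (X : Type) (s : seq X) (U : X -> set 'rV[K]_d) (r : X -> K)
    (t delta : K) A : 0 <= t ->
  (forall x : X, 0 <= r x <= delta) -> (forall x : X, (diam (U x) <= (r x)%:E)%E) ->
  A `<=` (fun y => has (fun x : X => `[< U x y >]) s) ->
  (hausdorff_content t delta A <= (\sum_(x <- s) r x `^ t)%:E)%E.
Proof.
move=> t0 rd Ur AU.
pose s' := [seq (U i, r i) | i <- s].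
pose V k := (nth (set0, 0) s' k).1.
pose F k := diam_pow t (V k).
have out k : (size s <= k)%N -> V k = set0.
  by move=> h; rewrite /V nth_default ?size_map.
have inn k : (k < size s)%N -> exists2 x : X, V k = U x & (nth (set0, 0) s' k).2 = r x.
  move=> h; have [x0 _] : exists x : X, True by case: s h {s' V F out AU} => // x ? _; exists x.
  by exists (nth x0 s k); rewrite /V (nth_map x0).
apply: (@le_trans _ _ (\sum_(0 <= k <oo) F k)%E).
  apply: ereal_inf_lbound; exists V => //; split.
    move=> k; case: (ltnP k (size s)) => h; last first.
      by rewrite out//; apply: ge_ereal_sup => _ [[? ?] [[]]].
    by have [x -> _] := inn k h; rewrite (le_trans (Ur x))// lee_fin; case/andP: (rd x).
  move=> y /AU hs; have [x0 _] : exists x : X, True by case: s hs {s' V F out inn AU} => // x ? _; exists x.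
  have /(has_nthP x0)[k ks /asboolP Uy] := hs; exists k => //.
  by rewrite /V (nth_map x0).
rewrite (nneseries_split 0 (size s)); last by move=> k _; exact: diam_pow_ge0.
rewrite add0n [X in (_ + X)%E]eseries0 ?adde0; last first.
  by move=> k h _; rewrite /F out// /diam_pow eqxx.
rewrite (_ : \sum_(i <- s) r i `^ t = \sum_(v <- s') v.2 `^ t); last first.
  by rewrite big_map.
rewrite (big_nth (set0, 0)) size_map -sumEFin.
rewrite big_nat_cond [leRHS]big_nat_cond; apply: lee_sum => k /andP[/andP[_ h] _].
have [x Vx ->] := inn k h; rewrite /F Vx diam_pow_le//.
by case/andP: (rd x).
Qed.

End Metric.

(** * Frostman weights from positive Hausdorff measure *)

Section Frostman.
Context {K : realType} {d : nat}.
Implicit Types (x y : 'rV[K]_d) (A B U : set 'rV[K]_d).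

Lemma exprn_powR (c t : K) k : 0 <= c -> (c ^+ k) `^ t = (c `^ t) ^+ k.
Proof.
move=> c0; rewrite -[c ^+ k]powR_mulrn// -powRrM mulrC powRrM powR_mulrn//.
exact: powR_ge0.
Qed.

Lemma pow2_small (c e : K) : 0 < e -> exists n, c * 2^-1 ^+ n <= e.
Proof.
move=> e0; pose n := Num.truncn `|c / e|; exists n.+1.
rewrite exprVn ler_pdivrMr ?exprn_gt0// mulrC -ler_pdivrMr//.
apply: le_trans (ler_norm _) _; apply/ltW.
apply: lt_trans (truncnS_gt _) _; rewrite -/n -natrX ltr_nat.
exact: ltn_expl.
Qed.

Lemma cell_close D i x y j : in_cube D x -> in_cube D y ->
  cell D i x = cell D i y -> `|(x - y) 0 j| <= 2^-1 ^+ i.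
Proof.
move=> xD yD e; have /andP[x1 x2] := cellP i j xD.
have /andP[y1 y2] := cellP i j yD; move: x1 x2 y1 y2; rewrite e -[_.+1%:R]natr1.
set X := _ * _; set Y := _ * (y _ _ + _); move=> x1 x2 y1 y2.
have p0 : 0 < 2 ^+ i :> K by rewrite exprn_gt0.
rewrite exprVn -[leRHS]div1r ler_pdivlMr// -[X in _ * X](gtr0_norm p0) -normrM.
have -> : (x - y) 0 j * 2 ^+ i = X - Y by rewrite /X /Y !mxE; ring.
by rewrite ler_norml; apply/andP; split; lra.
Qed.

Lemma cell_diam D i (c : {ffun 'I_d -> nat}) :
  (diam (fun y => in_cube D y /\ cell D i y = c) <= (d%:R * 2^-1 ^+ i)%:E)%E.
Proof.
apply: diam_le => x y [xD xc] [yD yc]; apply: enorm_le; first by rewrite exprn_ge0.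
by move=> j; apply: (cell_close (D := D)); rewrite // xc yc.
Qed.

Lemma cell_refine D i x y : in_cube D x -> in_cube D y ->
  cell D i.+1 x = cell D i.+1 y -> cell D i x = cell D i y.
Proof.
have H (z : 'rV[K]_d) j : in_cube D z -> cell D i z j = (cell D i.+1 z j)./2.
  move=> zD; have /andP[z1 z2] := cellP i.+1 j zD.
  rewrite [LHS]ffunE; apply: truncn_def.
  move: (cell _ _ _ _) z1 z2 => m z1 z2.
  have em : m%:R = (odd m)%:R + 2 * (m./2)%:R :> K.
    by rewrite -natrM -natrD mul2n odd_double_half.
  have o1 : (odd m)%:R <= 1 :> K by case: (odd m).
  have o0 : 0 <= (odd m)%:R :> K by [].
  move: z1 z2; rewrite exprS -mulrA -[m.+1%:R]natr1 -[_./2.+1%:R]natr1 em.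
  set Z := 2 ^+ i * _ => z1 z2.
  by apply/andP; split; lra.
by move=> xD yD e; apply/ffunP => j; rewrite !H// e.
Qed.

Lemma in_cube_code D i y : in_cube D y -> exists c : {ffun 'I_d -> 'I_(2 * D * 2 ^ i).+1},
  cell D i y = [ffun j => c j : nat].
Proof.
move=> yD; exists [ffun j => inord (cell D i y j)]; apply/ffunP => j.
by rewrite [RHS]ffunE [X in _ = nat_of_ord X]ffunE inordK// ltnS ltnW// cell_lt.
Qed.

Lemma hausdorff_measure_ge0 t A : (0 <= hausdorff_measure t A)%E.
Proof.
apply: (@le_trans _ _ (hausdorff_content t 1 A)); last first.
  by apply: ereal_sup_ubound; exists 1 => //=; exact: ltr01.
apply: le_ereal_inf_tmp => _ [U _ <-]; apply: nneseries_ge0 => k _ _.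
exact: diam_pow_ge0.
Qed.

(** A bounded set meets [O(2^(nd))] cells of diameter [O(2^-n)], so the [(d+1)]-sums tend to 0. This
    makes the set under the infimum in [hausdorff_dim] nonempty, so that the infimum is a genuine
    one. *)
Lemma hausdorff_measure_cube D A : A `<=` in_cube D ->
  hausdorff_measure d.+1%:R A = 0%E.
Proof.
move=> AD; apply/eqP; rewrite eq_le hausdorff_measure_ge0 andbT.
apply: ge_ereal_sup => _ [delta /= delta0 <-]; apply/lee_addgt0Pr => e e0.
rewrite add0e.
pose c : K := (2 * D).+1%:R ^+ d * d%:R ^+ d.+1.
have [n1 h1] := pow2_small c e0; have [n2 h2] := pow2_small d%:R delta0.
pose n := maxn n1 n2.
have mono k : (k <= n)%N -> 2^-1 ^+ n <= 2^-1 ^+ k :> K.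
  by move=> kn; rewrite !exprVn lef_pV2 ?posrE ?exprn_gt0// ler_eXn2l// ltr1n.
pose W := (2 * D * 2 ^ n)%N.
pose U (c : {ffun 'I_d -> 'I_W.+1}) : set 'rV[K]_d :=
  fun y => in_cube D y /\ cell D n y = [ffun j => c j : nat].
apply: le_trans (@hausdorff_content_le K d _ (enum {ffun 'I_d -> 'I_W.+1}) U
  (fun=> d%:R * 2^-1 ^+ n) _ _ _ _ _ _ _) _ => //.
- move=> _; rewrite mulr_ge0 ?exprn_ge0//=; apply: le_trans h2.
  by rewrite ler_wpM2l// mono// leq_maxr.
- by move=> x; exact: cell_diam.
- move=> y /AD yD; have [k e'] := in_cube_code n yD.
  by apply/hasP; exists k; [rewrite mem_enum|apply/asboolP].
rewrite lee_fin big_enum /= sumr_const card_ffun !card_ord.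
rewrite powR_mulrn ?mulr_ge0 ?exprn_ge0// -[leLHS]mulr_natl natrX.
apply: le_trans h1; apply: (@le_trans _ _ (c * 2^-1 ^+ n)); last first.
  by rewrite ler_wpM2l ?mulr_ge0 ?exprn_ge0// mono// leq_maxl.
apply: (@le_trans _ _ (((2 * D).+1%:R * 2 ^+ n) ^+ d * (d%:R * 2^-1 ^+ n) ^+ d.+1)).
  rewrite ler_wpM2r ?exprn_ge0 ?mulr_ge0 ?exprn_ge0// lerXn2r ?nnegrE ?mulr_ge0 ?exprn_ge0//.
  by rewrite -natrX -natrM ler_nat /W [leqRHS]mulSn -add1n leq_add2r expn_gt0.
rewrite le_eqVlt; apply/orP; left; apply/eqP.
rewrite /c !exprMn (exprS (2^-1 ^+ n)) exprVn.
have : (2 ^+ n) ^+ d != 0 :> K by rewrite !expf_neq0.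
have : 2 ^+ n != 0 :> K by rewrite !expf_neq0.
set z := 2 ^+ n => z0 zd0; rewrite exprVn; field.
by rewrite zd0 z0.
Qed.

Lemma content_gt0 t A : hausdorff_measure t A != 0%E ->
  exists2 delta, 0 < delta & (0 < hausdorff_content t delta A)%E.
Proof.
move=> H; apply: contrapT => /forall2NP h; move/negP: H; apply.
rewrite eq_le hausdorff_measure_ge0 andbT.
apply: ge_ereal_sup => _ [delta /= delta0 <-].
by case: (h delta) => // /negP; rewrite -leNgt.
Qed.

(** A maximal saturated family covers [B] by admissible cells, so its [t]-sum is at least the
    positive content; since that sum is at most a multiple of the total mass, normalizing the
    weights costs a constant independent of [n]. *)
Lemma frostman D B (t : K) : (0 < d)%N -> 0 <= t -> B !=set0 -> B `<=` in_cube D ->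
  hausdorff_measure t B != 0%E ->
  exists2 C, 0 < C & forall n, exists (J : finType) (v : J -> K) (q : J -> 'rV[K]_d),
  [/\ weights v, forall k, B (q k) &
    forall i c, (i <= n)%N ->
      \sum_(k | cell D i (q k) == c) v k <= C * (2^-1 `^ t) ^+ i].
Proof.
move=> dpos t0 [y0 By0] BD /content_gt0[delta delta0 cont].
set b := 2^-1 `^ t.
have b0 : 0 < b by rewrite powR_gt0.
have [eta eta0 etaP] : exists2 eta : K, 0 < eta & (eta%:E <= hausdorff_content t delta B)%E.
  move: cont; case: (hausdorff_content t delta B) => [r|_|].
  - by rewrite lte_fin => r0; exists r; rewrite ?lexx.
  - by exists 1; rewrite ?leey.
  - by [].
have b1 : b <= 1.
  rewrite /b -[leRHS](powRr0 (2^-1 : K)) ger_powR//.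
  by rewrite invr_gt0 ltr0n invf_le1 ?ler1n.
have [j0 hj0] := pow2_small d%:R delta0.
have dt0 : 0 < d%:R `^ t :> K by rewrite powR_gt0// ltr0n.
(* The first term serves levels [i >= j0], through total mass at least [eta / d^t]; the second
   serves [i < j0], where mass at most 1 is enough. *)
pose C := d%:R `^ t / eta + b ^- j0.
have C0 : 0 < C by rewrite addr_gt0 ?divr_gt0 ?invr_gt0 ?exprn_gt0.
exists C => // n'.
pose n := maxn n' j0.
pose W := (2 * D * 2 ^ n)%N.
pose P : finType := {ffun 'I_d -> 'I_W.+1}.
pose hit (c : P) y := B y /\ cell D n y = [ffun j => c j : nat].
pose act (c : P) := `[< exists y, hit c y >].
(* Cells that miss [B] are represented by [y0], so that every representative lies in [B]. *)
pose rep (c : P) := if pselect (exists y, hit c y) is left h then projT1 (cid h) else y0.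
have repB c : B (rep c).
  by rewrite /rep; case: pselect => // h; case: (cid h) => y [].
have repE c : act c -> cell D n (rep c) = [ffun j => c j : nat].
  by move=> /asboolP h; rewrite /rep; case: pselect => // {}h; case: (cid h) => y [].
pose q j c := cell D j (rep c).
have ref j c c' : q j.+1 c = q j.+1 c' -> q j c = q j c'.
  by apply: cell_refine; apply: BD; exact: repB.
have inj c c' : act c -> act c' -> q n c = q n c' -> c = c'.
  move=> ac ac'; rewrite /q !repE// => /ffunP e; apply/ffunP => j.
  by apply/val_inj; have := e j; rewrite !ffunE.
have j0n : (j0 <= n)%N by rewrite leq_maxr.
have [w wtree] := exists_tree_weights b0 ref inj j0n.
have [s [slev scov ssum]] := saturated_cover ref wtree.
have [w0 wle _] := wtree.
set tot := \sum_c w c in ssum.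
have tot_ge : eta <= d%:R `^ t * tot.
  rewrite -lee_fin; apply: le_trans etaP _.
  (* The covering lemma requires bounds for every index; those of level below [j0], absent from [s],
     get the empty set. *)
  pose r (x : nat * {ffun 'I_d -> nat}) : K := if (j0 <= x.1)%N then d%:R * 2^-1 ^+ x.1 else 0.
  pose U (x : nat * {ffun 'I_d -> nat}) : set 'rV[K]_d :=
    if (j0 <= x.1)%N then (fun y => in_cube D y /\ cell D x.1 y = x.2) else set0.
  apply: le_trans (@hausdorff_content_le K d _ s U r t delta B t0 _ _ _) _.
  - move=> x; rewrite /r; case: ifP => h; last by rewrite lexx ltW.
    rewrite mulr_ge0 ?exprn_ge0//=; apply: le_trans hj0.
    rewrite ler_wpM2l// !exprVn lef_pV2 ?posrE ?exprn_gt0// ler_eXn2l// ltr1n//.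
  - move=> x; rewrite /U /r; case: ifP => h; first exact: cell_diam.
    by apply: ge_ereal_sup => _ [[? ?] [[]]].
  - move=> y By; have yD := BD y By; have [c hc] := in_cube_code n yD.
    have ac : act c by apply/asboolP; exists y.
    have [x xs qx] := scov c ac; apply/hasP; exists x => //; apply/asboolP.
    have /andP[h1 h2] := slev x xs; rewrite /U h1; split => //.
    rewrite -qx /q.
    have : cell D n y = cell D n (rep c) by rewrite repE.
    rewrite -(subnKC h2); elim: (n - x.1)%N => [|k IH]; first by rewrite addn0.
    by rewrite addnS => /(cell_refine yD (BD _ (repB c))).
  rewrite lee_fin; apply: (@le_trans _ _ (\sum_(x <- s) d%:R `^ t * b ^+ x.1)).
    rewrite big_seq [leRHS]big_seq; apply: ler_sum => x xs.
    have /andP[h1 h2] := slev x xs; rewrite /r h1 powRM ?exprn_ge0//.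
    by rewrite exprn_powR.
  by rewrite -mulr_sumr ler_wpM2l ?powR_ge0.
have tot0 : 0 < tot by rewrite -(pmulr_rgt0 _ dt0) (lt_le_trans eta0).
exists P, (fun c => w c / tot), rep; split => //.
  split=> [c|]; first by rewrite divr_ge0// ltW.
  by rewrite -mulr_suml divff// gt_eqF.
move=> i c iN'; have iN : (i <= n)%N by rewrite leq_max iN'.
rewrite -mulr_suml ler_pdivrMr//.
have [ji|ij] := leqP j0 i.
  apply: (@le_trans _ _ (b ^+ i)).
    have [p /eqP hp|A0] := pickP (fun k => cell D i (rep k) == c); last first.
      by rewrite big1 ?exprn_ge0 ?ltW// => k; rewrite A0.
    by apply: le_trans (wle i p _); rewrite ?ji ?iN// /mass /q hp.
  rewrite mulrAC ler_peMl ?exprn_ge0 ?(ltW b0)//.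
  apply: (@le_trans _ _ (d%:R `^ t / eta * tot)).
    by rewrite mulrAC ler_pdivlMr// mul1r.
  by rewrite ler_wpM2r ?(ltW tot0)// /C lerDl invr_ge0 exprn_ge0 ?ltW.
apply: (@le_trans _ _ tot).
  rewrite /tot [leRHS](bigID (fun k => cell D i (rep k) == c)) /= lerDl.
  by apply: sumr_ge0.
rewrite ler_peMl ?(ltW tot0)//.
apply: (@le_trans _ _ (b ^- j0 * b ^+ i)).
  rewrite mulrC ler_pdivlMr ?exprn_gt0// mul1r.
  by apply: ler_wiXn2l; rewrite ?(ltW b0)// ltnW.
by rewrite ler_wpM2r ?exprn_ge0 ?(ltW b0)// /C lerDr divr_ge0 ?powR_ge0// ltW.
Qed.

End Frostman.

(** * Discretization of a measure with Fourier decay *)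

Lemma compact_seq_cover (T : ptopologicalType) (A : set T) (I : choiceType)
    (D : set I) (f : I -> set T) : compact A -> (forall i, D i -> open (f i)) ->
  (forall x, A x -> exists2 i, D i & f i x) ->
  exists s : seq I, (forall i, i \in s -> D i) /\
    (forall x, A x -> exists2 i, i \in s & f i x).
Proof.
rewrite compact_cover => cA fo cov.
have [x Ax|F FD AF] := cA I D f fo; first by have [i Di fi] := cov x Ax; exists i.
exists (finmap.enum_fset F); split=> [i iF|x /AF[i /= iF fx]]; last by exists i.
by have := FD i iF; rewrite inE.
Qed.

Section Discretize.
Context {K : realType} {d : nat}.
Implicit Types (mu : {finite_measure set (borel_rV K d) -> \bar K}).

Lemma open_measurable_rV (U : set 'rV[K]_d) : open U -> measurable (U : set (borel_rV K d)).
Proof. by move=> oU; exact: sub_sigma_algebra. Qed.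

Lemma continuous_measurable_rV (f : 'rV[K]_d -> K) : continuous f ->
  measurable_fun setT (f : borel_rV K d -> K).
Proof.
move=> /continuousP cf; apply: (measurability _ (measurable_realfun.RGenOInfty.measurableE K)).
move=> _ [_ [a ->] <-]; rewrite setTI; apply: open_measurable_rV.
by apply: cf; exact: interval_open.
Qed.

Lemma ball_rV (x y : 'rV[K]_d) e : ball x e y -> forall j, `|(x - y) 0 j| < e.
Proof. by move=> [_ h] j; have := h 0 j; rewrite /ball /= !mxE. Qed.

Lemma box_compact (N : nat) : compact [set v : 'rV[K]_d | forall j, `[- N%:R, N%:R]%classic (v ord0 j)].
Proof.
apply: (@rV_compact K d (fun=> `[- N%:R, N%:R]%classic)) => _.
exact: segment_compact.
Qed.

Lemma exists_cube (x : 'rV[K]_d) : exists N, forall j, `|x 0 j| < N%:R.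
Proof.
exists (\max_(j < d) (Num.truncn `|x ord0 j|%R).+1)%N => j.
apply: lt_le_trans (truncnS_gt _) _; rewrite ler_nat.
exact: (leq_bigmax (F := fun j => (Num.truncn `|x ord0 j|%R).+1)).
Qed.

Lemma compact_in_cube (A : set 'rV[K]_d) : compact A -> exists D, A `<=` in_cube D.
Proof.
move=> cA.
have [||s [_ H]] := @compact_seq_cover _ A _ setT (fun x : 'rV[K]_d => ball x 1) cA.
- by move=> x _; exact: ball_open.
- by move=> x _; exists x => //; exact: ballxx.
pose N x := projT1 (cid (exists_cube x)).
have NP (x : 'rV[K]_d) : forall j, `|x 0 j| < (N x)%:R by exact: (projT2 (cid (exists_cube x))).
exists (\sum_(x <- s) N x).+1%N => y Ay j.
have [x xs /ball_rV /(_ j)] := H y Ay; rewrite !mxE => xy.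
have xN := NP x j.
have NS : (N x)%:R <= (\sum_(x <- s) N x)%:R :> K.
  by rewrite ler_nat (big_rem x)//= leq_addr.
suff : `|y 0 j| < (\sum_(x <- s) N x).+1%:R.
  by rewrite ltr_norml => /andP[h1 h2]; rewrite h2 ltW.
rewrite -[ltRHS]natr1; have := ler_normD (y 0 j - x 0 j) (x 0 j).
by rewrite subrK distrC; lra.
Qed.

(** The complement of [U] is a countable union of compact sets, each covered by finitely many null
    open sets around points outside the support. *)
Lemma msupport_null mu (U : set 'rV[K]_d) : open U -> msupport mu `<=` U ->
  mu (~` U) = 0%E.
Proof.
move=> oU SU.
have mUC : measurable (~` U : set (borel_rV K d)).
  by apply: measurableC; exact: open_measurable_rV.
apply/negligibleP => //.
pose G (N : nat) : set (borel_rV K d) :=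
  ~` U `&` [set v : 'rV[K]_d | forall j, `[- N%:R, N%:R]%classic (v ord0 j)].
have UG : ~` U `<=` \bigcup_N G N.
  move=> x Ux; have [N NP] := exists_cube x; exists N => //; split => // j.
  by rewrite /= in_itv /= -ler_norml ltW.
apply: (@negligibleS _ (borel_rV K d) K mu _ _ UG).
apply: negligible_bigcup => N.
have : compact ([set v : 'rV[K]_d | forall j, `[- N%:R, N%:R]%classic (v ord0 j)] `&` ~` U).
  by apply: compact_closedI; [exact: box_compact|exact: open_closedC].
rewrite setIC; set C := _ `&` _ => cC.
have ex x : exists V : set 'rV[K]_d, (~` U) x -> [/\ open V, V x & (mu V <= 0)%E].
  have [Ux|Ux] := pselect (U x); first by exists set0.
  have /existsNP[V] : ~ msupport mu x by move/SU.
  move=> /not_implyP[oV /not_implyP[Vx /negP]]; rewrite -leNgt => V0.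
  by exists V.
pose V x := projT1 (cid (ex x)).
have VP x : (~` U) x -> [/\ open (V x), V x x & (mu (V x) <= 0)%E].
  exact: (projT2 (cid (ex x))).
have [||s [sU CF]] := @compact_seq_cover _ C _ (~` U) V cC.
- by move=> x /VP[].
- by move=> x [Ux _]; exists x => //; have [] := VP x Ux.
have CV : C `<=` (\big[setU/set0]_(x <- s) V x).
  by move=> x /CF[y ys Vy]; rewrite -bigcup_seq; exists y.
apply: (@negligibleS _ (borel_rV K d) K mu _ _ (CV : G N `<=` _)); move: s sU {CF CV}.
elim=> [|x s IH] sU; first by rewrite big_nil; exact: negligible_set0.
rewrite big_cons; apply: negligibleU; last first.
  by apply: IH => y ys; apply: sU; rewrite inE ys orbT.
have [oV _ V0] := VP x (sU x (mem_head _ _)).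
apply/negligibleP; first exact: open_measurable_rV.
by apply/eqP; rewrite eq_le V0 measure_ge0.
Qed.

Lemma integrable_bounded1 mu (E : set (borel_rV K d)) (f : 'rV[K]_d -> K) :
  measurable E -> measurable_fun setT (f : borel_rV K d -> K) ->
  (forall x, `|f x| <= 1) -> mu.-integrable E (EFin \o f).
Proof.
move=> mE mf f1; apply: measurable_bounded_integrable => //.
- by rewrite ltey_eq fin_num_measure.
- exact: measurable_funTS.
- by exists 1; split => // M M1 x _ /=; rewrite (le_trans (f1 x))// ltW.
Qed.

Lemma near_const_integral mu (E : set (borel_rV K d)) (f : 'rV[K]_d -> K) (c eta : K) :
  measurable E -> measurable_fun setT (f : borel_rV K d -> K) ->
  (forall x, `|f x| <= 1) -> (forall x, E x -> `|f x - c| <= eta) ->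
  `|(\int[mu]_(x in E) f x)%R - c * fine (mu E)| <= eta * fine (mu E).
Proof.
move=> mE mf f1 fc.
have fin : (mu E < +oo)%E by rewrite ltey_eq fin_num_measure.
have intf : mu.-integrable E (EFin \o f) by exact: integrable_bounded1.
have intc (z : K) : mu.-integrable E (EFin \o (cst z : borel_rV K d -> K)).
  apply: measurable_bounded_integrable => //.
  by exists `|z|; split => // M M1 x _ /=; rewrite ltW.
rewrite -[c * _](@Rintegral_cst _ _ _ mu E mE c) -RintegralB//; last exact: (intc c).
have intB : mu.-integrable E (EFin \o (fun x => f x - c)).
  exact: (integrableB mE intf (intc c)).
apply: le_trans (le_normr_Rintegral mE intB) _.
rewrite -[eta * _](@Rintegral_cst _ _ _ mu E mE eta); apply: le_Rintegral => //.
  exact: (integrable_norm intB).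
exact: (intc eta).
Qed.

(** The mass of each piece of a partition subordinate to [eps]-balls is moved to the centre of its
    ball. Points and masses are fixed before [f], so that one discretization serves all frequencies
    resolved at scale [eps]. *)
Lemma discretize mu (eps : K) : compact (msupport mu) -> mu setT != 0%E -> 0 < eps ->
  exists M (x : 'I_M -> 'rV[K]_d) (a : 'I_M -> K),
  [/\ forall i, 0 <= a i, \sum_i a i = fine (mu setT), forall i, msupport mu (x i) &
    forall (f : 'rV[K]_d -> K) (eta : K),
      measurable_fun setT (f : borel_rV K d -> K) -> (forall y, `|f y| <= 1) ->
      (forall y z : 'rV[K]_d, (forall j, `|(y - z) 0 j| < eps) -> `|f y - f z| <= eta) ->
      `|(\int[mu]_y f y)%R - \sum_i a i * f (x i)| <= eta * fine (mu setT)].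
Proof.
move=> cS mu0 eps0.
have [||s [sS cov]] := @compact_seq_cover _ _ _ (msupport mu)
    (fun x : 'rV[K]_d => ball x eps) cS.
- by move=> x _; exact: ball_open.
- by move=> x Sx; exists x => //; exact: ballxx.
have [x0 Sx0] : exists x, msupport mu x.
  apply: contrapT => h; move/negP: mu0; apply; apply/eqP.
  rewrite -setC0; apply: msupport_null; first exact: open0.
  by move=> x Sx; apply: h; exists x.
pose x m := nth x0 s m.
have Sx m : msupport mu (x m).
  case: (ltnP m (size s)) => h; first by apply: sS; rewrite mem_nth.
  by rewrite /x nth_default.
pose F m : set (borel_rV K d) := ball (x m) eps.
have mF m : measurable (F m) by apply: open_measurable_rV; exact: ball_open.
pose U m := \big[setU/set0]_(i < m) F i.
have mU m : measurable (U m) by apply: bigsetU_measurable.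
(* Removing the earlier balls makes the pieces disjoint while keeping each within [eps] of its
   centre. *)
pose E m := F m `\` U m.
have mE m : measurable (E m) by apply: measurableD.
have US m : U m.+1 = U m `|` E m.
  have -> : U m.+1 = U m `|` F m by exact: big_ord_recr.
  by rewrite /E setDE [RHS]setUIr setUv setIT.
have UE0 m : U m `&` E m = set0 by rewrite /E setDE setICA setICr setI0.
pose a m := fine (mu (E m)).
have fin (G : set (borel_rV K d)) : measurable G -> mu G \is a fin_num.
  by move=> mG; exact: fin_num_measure.
have muUS m : fine (mu (U m.+1)) = fine (mu (U m)) + a m.
  by rewrite US measureU// fineD// fin.
have muU m : fine (mu (U m)) = \sum_(i < m) a i.
  elim: m => [|m IH]; first by rewrite /U !big_ord0 measure0.
  by rewrite muUS IH big_ord_recr.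
set N := size s.
have oU : open (U N : set 'rV[K]_d).
  have : forall m, open (U m : set 'rV[K]_d); last exact.
  elim=> [|m IH]; first by rewrite /U big_ord0; exact: open0.
  have -> : U m.+1 = U m `|` F m by exact: big_ord_recr.
  by apply: openU => //; exact: ball_open.
have SU : msupport mu `<=` U N.
  move=> y /cov[z zs zy]; rewrite /U -bigcup_mkord; exists (index z s).
    by rewrite /= index_mem.
  by rewrite /F /x nth_index.
have UC0 : mu (~` U N) = 0%E by exact: msupport_null.
have mUC : measurable (~` U N) by exact: measurableC.
have muT : fine (mu setT) = fine (mu (U N)).
  have dis : U N `&` ~` U N = set0 by exact: setICr.
  have e : mu setT = (mu (U N) + mu (~` U N))%E.
    by rewrite -(setUv (U N)); exact: measureU.
  by rewrite e UC0 adde0.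
exists N, (fun i => x i), (fun i => a i); split=> //.
- by move=> i; rewrite fine_ge0.
- by rewrite muT muU.
move=> f eta mf f1 fosc.
have int (G : set (borel_rV K d)) : measurable G -> mu.-integrable G (EFin \o f).
  by move=> mG; exact: integrable_bounded1.
have approx m : `|(\int[mu]_(y in U m) f y)%R - \sum_(i < m) a i * f (x i)| <=
    eta * fine (mu (U m)).
  elim: m => [|m IH].
    by rewrite /U !big_ord0 Rintegral_set0 subrr normr0 measure0 mulr0.
  rewrite US Rintegral_setU//; last 2 first.
  - by apply: int; exact: measurableU.
  - by apply/disj_setPS; rewrite UE0.
  rewrite big_ord_recr /= measureU// fineD ?fin// mulrDr.
  set A := Rintegral _ _ _ in IH *; set B := Rintegral _ _ _; set S := \sum_(_ < _) _ in IH *.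
  have -> : A + B - (S + a m * f (x m)) = (A - S) + (B - a m * f (x m)) by ring.
  apply: le_trans (ler_normD _ _) (lerD IH _).
  rewrite mulrC; apply: near_const_integral => // y [Fy _].
  by rewrite distrC; apply: fosc; exact: ball_rV.
have -> : (\int[mu]_y f y)%R = (\int[mu]_(y in U N) f y)%R.
  rewrite -[in LHS](setUv (U N)) Rintegral_setU//; last 2 first.
  - by rewrite setUv; apply: int.
  - by apply/disj_setPS; rewrite setICr.
  have : `|(\int[mu]_(y in ~` U N) f y)%R - 0 * fine (mu (~` U N))| <= 1 * fine (mu (~` U N)).
    by apply: near_const_integral => // y _; rewrite subr0.
  by rewrite UC0 mul1r mulr0 subr0 normr_le0 => /eqP ->; rewrite addr0.
by rewrite muT.
Qed.

Lemma cos_lipschitz (x y : K) : `|cos x - cos y| <= `|x - y|.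
Proof.
wlog xy : x y / y <= x => [H|].
  by case: (leP y x) => h; [exact: H|rewrite -normrN opprB -[leRHS]normrN opprB H// ltW].
have [c _ ->] : exists2 c, c \in `[y, x]%R & cos x - cos y = (- sin c) * (x - y).
  apply: (@MVT_segment K cos (fun c => - sin c)) => //.
  by apply: continuous_subspaceT; exact: continuous_cos.
by rewrite normrM normrN ler_piMl// sin_max.
Qed.

Lemma sin_lipschitz (x y : K) : `|sin x - sin y| <= `|x - y|.
Proof.
wlog xy : x y / y <= x => [H|].
  by case: (leP y x) => h; [exact: H|rewrite -normrN opprB -[leRHS]normrN opprB H// ltW].
have [c _ ->] : exists2 c, c \in `[y, x]%R & sin x - sin y = cos c * (x - y).
  apply: MVT_segment => //.
  by apply: continuous_subspaceT; exact: continuous_sin.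
by rewrite normrM ler_piMl// cos_max.
Qed.

Lemma dotp_le (x xi : 'rV[K]_d) (r m : K) : 0 <= r ->
  (forall j, `|x 0 j| <= r) -> (forall j, `|xi 0 j| <= m) ->
  `|dotp x xi| <= d%:R * (r * m).
Proof.
move=> r0 xr xm; apply: le_trans (ler_norm_sum _ _ _) _.
apply: (@le_trans _ _ (\sum_(j < d) r * m)).
  by apply: ler_sum => j _; rewrite normrM ler_pM.
by rewrite sumr_const card_ord -[leLHS]mulr_natl.
Qed.

Lemma continuous_dotp (xi : 'rV[K]_d) : continuous (dotp^~ xi).
Proof.
suff H (r : seq 'I_d) : continuous (fun x : 'rV[K]_d => \sum_(j <- r) x 0 j * xi 0 j).
  exact: H.
elim: r => [|j r IH].
  have -> : (fun x : 'rV[K]_d => \sum_(j <- [::]) x 0 j * xi 0 j) = cst 0.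
    by apply/funext => x; rewrite big_nil.
  exact: cst_continuous.
have -> : (fun x : 'rV[K]_d => \sum_(i <- j :: r) x 0 i * xi 0 i) =
    (fun x => x 0 j * xi 0 j + \sum_(i <- r) x 0 i * xi 0 i).
  by apply/funext => x; rewrite big_cons.
move=> x; apply: (@continuousD K K^o 'rV[K]_d); last exact: IH.
apply: (@continuousM K 'rV[K]_d); first exact: coord_continuous.
exact: cst_continuous.
Qed.

End Discretize.

(** * Finite approximations at a given exponent *)

Section Approximations.
Context {K : realType} {d : nat}.

(* [a] and [b] stand for [2^-s] and [2^-t], with [s] the Fourier decay exponent
   and [t] the Frostman exponent; [n] is the finest scale that is resolved. *)
Definition fourier_approx (A : set 'rV[K]_d) (a : K) :=
  exists2 C, 0 < C & forall n, exists (I : finType) (w : I -> K) (p : I -> 'rV[K]_d),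
  [/\ weights w, forall i, A (p i) &
    forall i (xi : 'rV[K]_d), (i < n)%N -> (exists k, (2 ^ i)%:R < `|xi 0 k|) ->
      (forall k, `|xi 0 k| <= (2 ^ i.+1)%:R) -> ft2 w p xi <= C * a ^+ i].

Definition frostman_approx D (B : set 'rV[K]_d) (b : K) :=
  exists2 C, 0 < C & forall n, exists (J : finType) (v : J -> K) (q : J -> 'rV[K]_d),
  [/\ weights v, forall k, B (q k) &
    forall i c, (i <= n)%N -> \sum_(k | cell D i (q k) == c) v k <= C * b ^+ i].

(** A unit mass at one point has exponent 0. This, like the next lemma, covers sets of dimension 0,
    where no positive exponent is available. *)
Lemma fourier_approx1 A : A !=set0 -> fourier_approx A 1.
Proof.
move=> [x Ax]; exists 1 => // n; exists unit, (fun=> 1), (fun=> x).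
have w1 : weights (fun _ : unit => 1 : K).
  by split => //; rewrite sumr_const card_unit.
split => // i xi _ _ _; rewrite expr1n mulr1; apply: ft2_le1; [exact: w1.1|exact: w1.2].
Qed.

Lemma frostman_approx1 D B : B !=set0 -> frostman_approx D B 1.
Proof.
move=> [x Bx]; exists 1 => // n; exists unit, (fun=> 1), (fun=> x).
have w1 : weights (fun _ : unit => 1 : K).
  by split => //; rewrite sumr_const card_unit.
split => // i c _; rewrite expr1n mulr1 big_mkcond.
apply: (@le_trans _ _ (\sum_(k : unit) 1)); last by rewrite w1.2.
by apply: ler_sum => k _; case: ifP.
Qed.

Lemma fourier_decay_approx (A : set 'rV[K]_d) (s C0 : K)
    (mu : {finite_measure set (borel_rV K d) -> \bar K}) :
  0 <= s -> measures_on A mu ->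
  (forall xi, ComplexField.Normc.normc (fourier mu xi) ^+ 2 * enorm xi `^ s <= C0) ->
  fourier_approx A (2^-1 `^ s).
Proof.
move=> s0 [mu0 cS SA] decay; set a := 2^-1 `^ s.
have a0 : 0 < a by rewrite powR_gt0.
have a1 : a <= 1.
  rewrite /a -[leRHS](powRr0 (2^-1 : K)) ger_powR//.
  by rewrite invr_gt0 ltr0n invf_le1 ?ler1n.
have C00 : 0 <= C0.
  by apply: le_trans (decay 0); rewrite mulr_ge0 ?sqr_ge0 ?powR_ge0.
set m := fine (mu setT).
have fin : mu setT \is a fin_num by exact: fin_num_measure.
have m0 : 0 < m.
  by rewrite /m fine_gt0// lt0e mu0 measure_ge0 ltey_eq fin.
exists (2 * C0 / m ^+ 2 + 4) => [|n].
  by apply: ltr_wpDl => //; rewrite divr_ge0 ?sqr_ge0 ?mulr_ge0.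
have pi0 := @pi_gt0 K.
(* The decay at the finest scale: since [eta <= a^i] for [i < n], the discretization error is
   absorbed in the bound at each resolved scale. *)
pose eta := a ^+ n.
have eta0 : 0 < eta by rewrite exprn_gt0.
(* At frequencies up to [2^n], moving each coordinate by [eta / den] changes the phase by at most
   [eta]. *)
pose den : K := 2 * pi * (d.+1%:R * 2 ^+ n).
have den0 : 0 < den by rewrite !mulr_gt0 ?exprn_gt0.
have eps0 : 0 < eta / den by rewrite divr_gt0.
have [M [x [w [w0 w1 xS approx]]]] := discretize cS mu0 eps0.
exists 'I_M, (fun i => w i / m), x; split.
- split=> [i|]; first by rewrite divr_ge0// ltW.
  by rewrite -mulr_suml w1 divff// gt_eqF.
- by move=> i; apply: SA.
move=> i xi iN [k xik] xil.
have xiln j : `|xi 0 j| <= 2 ^+ n.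
  by apply: le_trans (xil j) _; rewrite natrX ler_eXn2l// ltr1n.
have osc (f : K -> K) : (forall u v, `|f u - f v| <= `|u - v|) ->
    (forall u, `|f u| <= 1) -> continuous f ->
    `|(\int[mu]_y f (- (2 * pi * dotp y xi)))%R -
      \sum_i w i * f (- (2 * pi * dotp (x i) xi))| <= eta * m.
  move=> flip f1 fcont; apply: (approx (fun y => f (- (2 * pi * dotp y xi)))) => //.
    apply: (@continuous_measurable_rV K d (fun y => f (- (2 * pi * dotp y xi)))) => y.
    apply: continuous_comp; last exact: fcont.
    apply: (@continuousN K K^o 'rV[K]_d).
    apply: (@continuousM K 'rV[K]_d); first exact: cst_continuous.
    exact: continuous_dotp.
  move=> y z yz; apply: le_trans (flip _ _) _.
  have -> : - (2 * pi * dotp y xi) - - (2 * pi * dotp z xi) = - (2 * pi * dotp (y - z) xi).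
    by rewrite dotpBl; ring.
  rewrite normrN normrM ger0_norm ?mulr_ge0 ?(ltW pi0)//.
  have := @dotp_le K d (y - z) xi (eta / den) (2 ^+ n) (ltW eps0) (fun j => ltW (yz j)) xiln.
  move=> h; apply: (@le_trans _ _ (2 * pi * (d.+1%:R * (eta / den * 2 ^+ n)))).
    rewrite ler_wpM2l ?mulr_ge0 ?(ltW pi0)//; apply: le_trans h _.
    apply: ler_wpM2r; first by rewrite mulr_ge0 ?(ltW eps0) ?exprn_ge0.
    by rewrite ler_nat.
  suff -> : 2 * pi * (d.+1%:R * (eta / den * 2 ^+ n)) = eta.
    exact: lexx.
  have -> : 2 * pi * (d.+1%:R * (eta / den * 2 ^+ n)) = eta / den * den.
    by move: (eta / den) => u; rewrite /den; ring.
  by rewrite divfK// gt_eqF.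
have hc := osc cos (@cos_lipschitz K) (@cos_max K) (@continuous_cos K).
have hs := osc sin (@sin_lipschitz K) (@sin_max K) (@continuous_sin K).
have dec := decay xi.
set Ic := Rintegral _ _ _ in hc; set Is := Rintegral _ _ _ in hs.
have normE : ComplexField.Normc.normc (fourier mu xi) ^+ 2 = Ic ^+ 2 + Is ^+ 2.
  rewrite /fourier /cintegral /= sqr_sqrtr// addr_ge0 ?sqr_ge0//.
rewrite normE in dec.
have ai0 : 0 < a ^+ i by rewrite exprn_gt0.
have I_le : Ic ^+ 2 + Is ^+ 2 <= C0 * a ^+ i.
  have e1 : a ^- i <= enorm xi `^ s.
    have -> : a ^- i = (2 ^+ i) `^ s.
      have -> : a = (2 `^ s)^-1 by rewrite -powRN -mulN1r powRrM powR_inv1.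
      by rewrite exprn_powR// exprVn invrK.
    rewrite ge0_ler_powR ?nnegrE ?sqrtr_ge0 ?exprn_ge0//.
    by apply: le_trans (coord_le_enorm xi k); rewrite -natrX ltW.
  rewrite -ler_pdivrMr//; apply: le_trans dec.
  by rewrite ler_wpM2l// addr_ge0 ?sqr_ge0.
have ftE : ft2 (fun i => w i / m) x xi =
    ((\sum_i w i * cos (- (2 * pi * dotp (x i) xi))) ^+ 2 +
    (\sum_i w i * sin (- (2 * pi * dotp (x i) xi))) ^+ 2) / m ^+ 2.
  rewrite mulrDl -!expr_div_n /ft2 !mulr_suml; congr (_ ^+ 2 + _).
    by apply: eq_bigr => j _; rewrite cosN mulrAC.
  rewrite -[RHS]sqrrN -sumrN; congr (_ ^+ 2).
  by apply: eq_bigr => j _; rewrite sinN mulrN mulNr opprK mulrAC.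
rewrite ftE.
set Sc := \sum_i _ in hc *; set Ss := \sum_i _ in hs *.
(* Applied to the cosine and the sine part, this gives the constants [2 C0] and 4. *)
have sq (X Y : K) : `|X - Y| <= eta * m -> Y ^+ 2 <= 2 * X ^+ 2 + 2 * (eta * m) ^+ 2.
  move=> h; have : (X - Y) ^+ 2 <= (eta * m) ^+ 2.
    by rewrite -real_normK ?num_real// lerXn2r ?nnegrE// mulr_ge0 ?ltW.
  have := sqr_ge0 (2 * X - Y); nra.
have eta_le : eta ^+ 2 <= a ^+ i.
  apply: (@le_trans _ _ (eta * 1)).
    rewrite expr2 ler_wpM2l ?(ltW eta0)// /eta exprn_ile1// ltW//.
  by rewrite mulr1 /eta; apply: ler_wiXn2l => //; [exact: ltW|exact: ltnW].
have m2 : 0 < m ^+ 2 by rewrite exprn_gt0.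
rewrite ler_pdivrMr//.
have -> : (2 * C0 / m ^+ 2 + 4) * a ^+ i * m ^+ 2 = 2 * (C0 * a ^+ i) + 4 * (a ^+ i * m ^+ 2).
  by field; rewrite gt_eqF.
have := sq _ _ hc; have := sq _ _ hs; rewrite exprMn.
have : eta ^+ 2 * m ^+ 2 <= a ^+ i * m ^+ 2 by rewrite ler_wpM2r// ltW.
lra.
Qed.

End Approximations.

(** * Sum sets *)

Section Powers.
Context {K : realType}.

(** The largest [j] with [r 2^j <= 1], found as the least [j] for which [j + 1] fails. *)
Lemma exists_level (r : K) : 0 < r <= 1 -> exists j, r * 2 ^+ j <= 1 /\ 2^-1 ^+ j <= 2 * r.
Proof.
move=> /andP[r0 r1].
have ex : exists j, 1 < r * 2 ^+ j.+1.
  have [j h] := pow2_small r^-1 (ltr01 : 0 < 1 :> K); exists j.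
  move: h; rewrite exprVn ler_pdivrMr ?exprn_gt0// mul1r => h.
  have : 1 <= r * 2 ^+ j by rewrite -ler_pdivrMl// mulr1.
  by rewrite exprS mulrCA; lra.
exists (ex_minn ex); case: ex_minnP => j hj minj; split.
  case: j hj minj => [|j] hj minj; first by rewrite mulr1.
  by rewrite leNgt; apply/negP => /minj; rewrite ltnn.
rewrite exprVn -div1r ler_pdivrMr ?exprn_gt0//.
by move: hj; rewrite exprS mulrCA mulrA => /ltW.
Qed.

(** Room to replace a set of diameter [r] by an open ball at a prescribed cost in the [u]-th power.
    For [u = 0] all powers are 1 and any larger radius does. *)
Lemma powR_enlarge (r delta u e : K) : 0 <= r -> 0 < delta -> 0 <= u -> 0 < e ->
  exists2 r', r < r' <= r + delta & r' `^ u <= r `^ u + e.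
Proof.
move=> r0 delta0; rewrite le_eqVlt => /orP[/eqP <- e0|u0 e0].
  exists (r + delta); first by rewrite ltrDl delta0 lexx.
  by rewrite !powRr0 lerDl ltW.
pose q := (r `^ u + e) `^ u^-1.
have q0 : 0 < r `^ u + e by rewrite ltr_wpDl// powR_ge0.
have qE : q `^ u = r `^ u + e.
  by rewrite /q -powRrM mulVf ?gt_eqF// powRr1// ltW.
have rq : r < q.
  rewrite ltNge; apply/negP => h.
  have : q `^ u <= r `^ u by rewrite ge0_ler_powR ?nnegrE ?powR_ge0// ltW.
  by rewrite qE; lra.
exists (Num.min q (r + delta)).
  by rewrite lt_min rq ltrDl delta0 ge_min lexx orbT.
rewrite -qE; apply: ge0_ler_powR; rewrite ?nnegrE ?(ltW u0) ?powR_ge0//.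
  by rewrite le_min powR_ge0 addr_ge0// ltW.
by rewrite ge_min lexx.
Qed.

End Powers.

(** * Finite subfamilies of enlarged covers *)

Section Series.
Context {K : realType}.

Lemma sum_uniq_le (s : seq nat) N (G : nat -> K) : (forall k, 0 <= G k) -> uniq s ->
  (forall k, k \in s -> (k < N)%N) -> \sum_(k <- s) G k <= \sum_(k < N) G k.
Proof.
move=> G0 us sN.
have pq : perm_eq s [seq k <- iota 0 N | k \in s].
  apply: uniq_perm => //; first by rewrite filter_uniq// iota_uniq.
  move=> k; rewrite mem_filter mem_iota add0n /=.
  by case: (boolP (k \in s)) => // /sN ->.
rewrite (perm_big _ pq) big_filter /= -(big_mkord xpredT G) /index_iota subn0.
rewrite [leRHS](bigID (mem s)) /= lerDl; exact: sumr_ge0.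
Qed.

Lemma sum_geom_half N : \sum_(k < N) 2^-1 ^+ k.+1 <= 1 :> K.
Proof.
suff -> : \sum_(k < N) 2^-1 ^+ k.+1 = 1 - 2^-1 ^+ N :> K.
  by rewrite lerBlDr lerDl exprn_ge0.
elim: N => [|N IH]; first by rewrite big_ord0 expr0 subrr.
by rewrite big_ord_recr /= IH exprS; field.
Qed.

(** The enlargements cost at most [e] in total, as their shares [2^-(k+1)] sum to at most 1; without
    repetitions in [s] the finite sum is dominated by the series. *)
Lemma sum_enlarged_le (F : nat -> \bar K) (G : nat -> K) (e : K) (s : seq nat) :
  0 < e -> (forall k, (0 <= F k)%E) -> (\sum_(0 <= k <oo) F k < e%:E)%E ->
  (forall k, 0 <= G k) -> (forall k, ((G k)%:E <= F k + (e * 2^-1 ^+ k.+1)%:E)%E) ->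
  uniq s -> \sum_(k <- s) G k <= 2 * e.
Proof.
move=> e0 F0 Fe G0 GF us.
pose N := (\max_(k <- s) k).+1.
have sN k : k \in s -> (k < N)%N by move=> ks; rewrite ltnS; exact: leq_bigmax_seq.
apply: le_trans (sum_uniq_le G0 us sN) _.
have h : ((\sum_(k < N) G k)%:E <= e%:E + e%:E)%E.
  rewrite -sumEFin.
  apply: (@le_trans _ _ (\sum_(k < N) (F k + (e * 2^-1 ^+ k.+1)%:E))%E).
    by apply: lee_sum => k _; exact: GF.
  rewrite big_split /=; apply: leeD.
    apply: le_trans (ltW Fe); rewrite -(big_mkord xpredT F).
    by apply: nneseries_lim_ge => k _ _; exact: F0.
  rewrite sumEFin lee_fin -mulr_sumr -[leRHS]mulr1 ler_wpM2l ?(ltW e0)//.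
  exact: sum_geom_half.
by move: h; rewrite -EFinD lee_fin; lra.
Qed.

Lemma prod_enlarge (I : Type) (r : seq I) (l : I -> K) : (forall j, 0 <= l j) ->
  exists2 C, 0 <= C & forall t, 0 <= t <= 1 ->
    \prod_(j <- r) (l j + t) <= \prod_(j <- r) l j + C * t.
Proof.
move=> l0; elim: r => [|j r [C C0 IH]].
  by exists 0 => // t _; rewrite !big_nil mul0r addr0.
have P0 : 0 <= \prod_(i <- r) l i by apply: prodr_ge0.
exists (l j * C + \prod_(i <- r) l i + C) => [|t t01].
  by rewrite !addr_ge0 ?mulr_ge0.
rewrite !big_cons; have /andP[t0 t1] := t01.
apply: (@le_trans _ _ ((l j + t) * (\prod_(i <- r) l i + C * t))).
  by rewrite ler_wpM2l ?IH// addr_ge0.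
have : C * t * t <= C * t by rewrite ler_piMr// mulr_ge0.
lra.
Qed.

End Series.

(** * Lower bounds for the size of [A + B] *)

Section SumSets.
Context {K : realType} {d : nat}.
Context (A B : set 'rV[K]_d) (D : nat) (a b : K).
Hypotheses (a0 : 0 < a) (b0 : 0 < b) (BD : B `<=` in_cube D).
Hypotheses (fA : fourier_approx A a) (fB : frostman_approx D B b).
Hypothesis (cAB : compact (sum_set A B)).

Lemma sum_set_energy (e : K) :
  (1 < 2 ^+ d * a * b /\ e = a * b) \/ (2 ^+ d * a * b < 1 /\ e = 2 ^- d) ->
  exists2 C, 0 < C & forall n, exists (I : finType) (w : I -> K) (p : I -> 'rV[K]_d),
  [/\ weights w, forall i, sum_set A B (p i) &
    forall j, (j <= n)%N ->
      \sum_i \sum_(i' | near_pair j (p i) (p i')) w i * w i' <= C * e ^+ j].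
Proof.
move=> he; have [ca ca0 hA] := fA; have [cb cb0 hB] := fB.
have [C C0 hC] := conv_energy_le D a0 b0 (ltW ca0) (ltW cb0) he.
exists C => // n; have [I [w [p [ww pA wp]]]] := hA n.
have [J [v [q [wv qB vq]]]] := hB n.
exists (I * J)%type, (fun k => w k.1 * v k.2), (fun k => p k.1 + q k.2).
split; first exact: weights_conv.
- by move=> [i j] /=; exists (p i) => //; exists (q j).
- by move=> j jn; apply: hC jn => // k; apply: BD.
Qed.

Lemma sum_set_volume : 2 ^+ d * a * b < 1 -> (0 < lebesgue_rV (sum_set A B))%E.
Proof.
have aux (l t X Y : K) :
    1 <= t * Y -> t * Y <= t * X -> 0 <= l * X -> 0 <= t * X ->
    1 <= (l + 2 * t) * X.
  by move=> *; lra.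
move=> ab; rewrite ltNge; apply/negP => leb.
have [C C0 hC] := sum_set_energy (or_intror (conj ab erefl)).
have C32 : 0 < 16 * C * 32 ^+ d by rewrite !mulr_gt0 ?exprn_gt0.
(* Enlarging the boxes doubles the total to [2 e], and [2 C 32^d] times [2 e] is 1/4, contradicting
   the lower bound 1/2. *)
pose e := (16 * C * 32 ^+ d)^-1.
have e0 : 0 < e by rewrite invr_gt0.
have : (lebesgue_rV (sum_set A B) < e%:E)%E by apply: le_lt_trans leb _; rewrite lte_fin.
move=> /ereal_inf_lt[_ [[x y] /= [xy cov] <-] sum_lt].
pose l k j := y k 0 j - x k 0 j.
have l0 k j : 0 <= l k j by rewrite subr_ge0.
have ek k : 0 < e * 2^-1 ^+ k.+1 by rewrite mulr_gt0 ?exprn_gt0.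
have ext k : exists2 t, 0 < t &
    \prod_j (l k j + 2 * t) <= \prod_j l k j + e * 2^-1 ^+ k.+1.
  have [c c0 h] := prod_enlarge (index_enum 'I_d) (l0 k).
  pose m := Num.min 1 (e * 2^-1 ^+ k.+1 / (c + 1)).
  have m0 : 0 < m by rewrite lt_min ltr01 divr_gt0// ltr_wpDl.
  exists (m / 2); first by rewrite divr_gt0.
  have -> : 2 * (m / 2) = m by field.
  apply: le_trans (h m _) _; first by rewrite ltW//= ge_min lexx.
  rewrite lerD2l; apply: (@le_trans _ _ (c * (e * 2^-1 ^+ k.+1 / (c + 1)))).
    by rewrite ler_wpM2l// ge_min lexx orbT.
  rewrite mulrA ler_pdivrMr ?ltr_wpDl// mulrC ler_wpM2l ?(ltW (ek k))//.
  by rewrite lerDl.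
pose t k := projT1 (cid2 (ext k)).
have t0 k : 0 < t k by rewrite /t; case: cid2.
have tP k : \prod_j (l k j + 2 * t k) <= \prod_j l k j + e * 2^-1 ^+ k.+1.
  by rewrite /t; case: cid2.
pose x' k : 'rV[K]_d := \row_j (x k 0 j - t k).
pose y' k : 'rV[K]_d := \row_j (y k 0 j + t k).
have side k j : y' k 0 j - x' k 0 j = l k j + 2 * t k by rewrite !mxE /l; ring.
have [||s0 [_ scov]] := @compact_seq_cover _ _ _ setT (fun k => interior (box (x' k) (y' k))) cAB.
- by move=> k _; exact: open_interior.
- move=> z /cov[k _ zk]; exists k => //.
  apply/nbhs_ballP; exists (t k) => //= z' /ball_rV zz' j.
  have := zz' j; have := zk j; rewrite !mxE ltr_norml => /andP[h1 h2] /andP[h3 h4].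
  by apply/andP; split; lra.
pose s := undup s0.
(* The margin [t k] bounds the sides from below, so some scale is finer than all boxes of the finite
   subcover, even those that were degenerate. *)
have pick k : exists n, (t k)^-1 * 2^-1 ^+ n <= 16 by apply: pow2_small.
pose nn k := projT1 (cid (pick k)).
pose n := (\max_(k <- s) nn k)%N.
have [I [w [p [ww pAB energy]]]] := hC n.
have := volume_ge (s := s) (a := x') (b := y') ww C0 (energy n (leqnn n)).
have cov' i : exists2 k, k \in s & box (x' k) (y' k) (p i).
  have [k ks kp] := scov _ (pAB i); exists k; first by rewrite mem_undup.
  exact: interior_subset kp.
have side' k j : k \in s -> 1 <= (y' k 0 j - x' k 0 j) * (16 * 2 ^+ n).
  move=> ks; rewrite side.
  have : (t k)^-1 * 2^-1 ^+ nn k <= 16 by exact: (projT2 (cid (pick k))).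
  have p0 : 0 < 2 ^+ nn k :> K by rewrite exprn_gt0.
  rewrite exprVn ler_pdivrMr// -[(t k)^-1]mulr1 ler_pdivrMl// => h1.
  have kn : 2 ^+ nn k <= 2 ^+ n :> K.
    by rewrite ler_eXn2l ?ltr1n//; exact: leq_bigmax_seq.
  apply: (aux _ _ _ _ h1).
  - by rewrite ler_wpM2l ?(ltW (t0 k))// ler_wpM2l.
  - by rewrite !mulr_ge0 ?exprn_ge0.
  - by rewrite !mulr_ge0 ?exprn_ge0// ltW.
move=> /(_ cov' side') main.
have : \sum_(k <- s) \prod_j (y' k 0 j - x' k 0 j) <= 2 * e.
  apply: (sum_enlarged_le e0 (F := fun k => (\prod_j (y k 0 j - x k 0 j))%:E)).
  - by move=> k; rewrite lee_fin; apply: prodr_ge0 => j _; exact: l0.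
  - exact: sum_lt.
  - by move=> k; apply: prodr_ge0 => j _; rewrite side addr_ge0// mulr_ge0// ltW.
  - move=> k; rewrite -EFinD lee_fin; apply: le_trans (tP k).
    by under eq_bigr do rewrite side.
  - exact: undup_uniq.
move=> small; move: main; apply/negP; rewrite -ltNge.
have C2 : 0 < 2 * C * 32 ^+ d by rewrite !mulr_gt0 ?exprn_gt0.
apply: (@le_lt_trans _ _ (2 * C * 32 ^+ d * (2 * e))); first by rewrite ler_wpM2l// ltW.
have -> : 2 * C * 32 ^+ d * (2 * e) = 1 / 4.
  have ne : 32 ^+ d != 0 :> K by rewrite expf_neq0.
  by rewrite /e; field; rewrite ne gt_eqF.
lra.
Qed.

(** A null set would have covers of arbitrarily small [u]-sum. The nonempty members are put into
    open balls, finitely many of which suffice, and [content_ge] with [g = 2^u] contradicts this;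
    [2^u a b < 1] means [u < s + t]. *)
Lemma sum_set_content (u : K) : 0 <= u -> 1 < 2 ^+ d * a * b ->
  2 `^ u * (a * b) < 1 -> hausdorff_measure u (sum_set A B) != 0%E.
Proof.
move=> u0 ab gab; apply/negP => /eqP H0.
have [C C0 hC] := sum_set_energy (or_introl (conj ab erefl)).
set g := 2 `^ u in gab.
have g0 : 0 < g by rewrite powR_gt0.
(* Diameters at most 1/64, enlarged by at most 1/64, give radii [r'] with [32 r' <= 1], as
   [exists_level] requires. *)
pose delta : K := 64^-1.
have delta0 : 0 < delta by rewrite invr_gt0.
(* The factor [64^u] comes from [2^-lev <= 64 r']. *)
pose M := 2 * (C / (1 - g * (a * b))) * 64 `^ u.
have M0 : 0 < M.
  by rewrite /M !mulr_gt0 ?powR_gt0 ?invr_gt0 ?subr_gt0.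
pose e := (8 * M)^-1.
have e0 : 0 < e by rewrite invr_gt0 mulr_gt0.
have : (hausdorff_content u delta (sum_set A B) < e%:E)%E.
  apply: (@le_lt_trans _ _ 0%E); last by rewrite lte_fin.
  by rewrite -H0; apply: ereal_sup_ubound; exists delta.
move=> /ereal_inf_lt[_ [U /= [Ud cov] <-] sum_lt].
have ek k : 0 < e * 2^-1 ^+ k.+1 by rewrite mulr_gt0 ?exprn_gt0.
pose good k := U k !=set0.
have data k : exists c : 'rV[K]_d * K, good k ->
    [/\ U k `<=` ball c.1 c.2, 0 < 32 * c.2 <= 1 &
      ((c.2 `^ u)%:E <= diam_pow u (U k) + (e * 2^-1 ^+ k.+1)%:E)%E].
  have [[x Ux]|] := pselect (good k); last by exists (0, 0).
  have d0 : (0 <= diam (U k))%E by apply: diam_ge0; exists x.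
  have [r rE] : exists r, diam (U k) = r%:E.
    by move: d0 (Ud k); case: (diam (U k)) => [r| |]//; exists r.
  have r0 : 0 <= r by move: d0; rewrite rE lee_fin.
  have rd : r <= delta by have := Ud k; rewrite rE lee_fin.
  have [r' /andP[rr' r'd] r'u] := powR_enlarge r0 delta0 u0 (ek k).
  exists (x, r') => _ /=; split.
  - move=> y Uy; split; first exact: le_lt_trans rr'.
    move=> i j; rewrite (ord1 i) /ball /=.
    have := coord_le_enorm (x - y) j; rewrite !mxE => h.
    apply: le_lt_trans h _; apply: le_lt_trans rr'.
    by have := enorm_le_diam Ux Uy; rewrite rE lee_fin.
  - apply/andP; split; first by rewrite mulr_gt0// (le_lt_trans r0).
    by move: rd r'd; rewrite /delta; lra.
  - rewrite /diam_pow; case: eqP => [e'|_]; first by rewrite e' in Ux.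
    by rewrite rE poweR_EFin -EFinD lee_fin.
pose c k := projT1 (cid (data k)).
have cP k : good k -> [/\ U k `<=` ball (c k).1 (c k).2, 0 < 32 * (c k).2 <= 1 &
      (((c k).2 `^ u)%:E <= diam_pow u (U k) + (e * 2^-1 ^+ k.+1)%:E)%E].
  exact: (projT2 (cid (data k))).
(* Two points of a ball of radius [r'] differ by at most [2 r'] in each coordinate, and
   [2 r' * 16 = 32 r']; so the points are near at level [lev k]. *)
have levex k : exists j, good k -> 32 * (c k).2 * 2 ^+ j <= 1 /\ 2^-1 ^+ j <= 2 * (32 * (c k).2).
  have [gk|] := pselect (good k); last by exists 0%N.
  by have [_ h _] := cP k gk; have [j ?] := exists_level h; exists j.
pose lev k := projT1 (cid (levex k)).
have levP k : good k -> 32 * (c k).2 * 2 ^+ lev k <= 1 /\ 2^-1 ^+ lev k <= 2 * (32 * (c k).2).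
  exact: (projT2 (cid (levex k))).
have [||s0 [s0good scov]] := @compact_seq_cover _ _ _ good (fun k => ball (c k).1 (c k).2) cAB.
- by move=> k _; exact: ball_open.
- move=> z /cov[k _ zk]; have gk : good k by exists z.
  by exists k => //; have [h _ _] := cP k gk; exact: h.
pose s := undup s0.
have sgood k : k \in s -> good k by rewrite mem_undup; exact: s0good.
pose n := (\max_(k <- s) lev k)%N.
have [I [w [p [ww pAB energy]]]] := hC n.
pose G k : K := if `[< good k >] then (c k).2 `^ u else 0.
pose inball k i := `[< ball (c k).1 (c k).2 (p i) >].
have ab0 : 0 < a * b by rewrite mulr_gt0.
have main : 1 / 2 <= 2 * (C / (1 - g * (a * b))) * \sum_(k <- s) 64 `^ u * G k.
  apply: (content_ge (n := n) (p := p) (ball := inball) (lev := lev) ww) => //.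
  - move=> i; have [k ks kp] := scov _ (pAB i).
    by exists k; [rewrite mem_undup|apply/asboolP].
  - move=> k i i' ks /asboolP /ball_rV h /asboolP /ball_rV h'.
    apply/forallP => j; have := h j; have := h' j; rewrite !mxE.
    have [lv _] := levP k (sgood k ks).
    have l0 : 0 < 16 * 2 ^+ lev k :> K by rewrite mulr_gt0 ?exprn_gt0.
    move=> h1 h2; have tri : `|p i 0 j - p i' 0 j| <= 2 * (c k).2.
      have -> : p i 0 j - p i' 0 j = (((c k).1 0 j - p i' 0 j) - ((c k).1 0 j - p i 0 j)) by ring.
      apply: le_trans (ler_normB _ _) _; rewrite mulr_natl mulr2n; apply: lerD; exact: ltW.
    apply: le_trans (_ : 2 * (c k).2 * (16 * 2 ^+ lev k) <= 1).
      by rewrite ler_wpM2r// ltW.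
    apply: le_trans lv; rewrite le_eqVlt; apply/orP; left; apply/eqP.
    by move: (2 ^+ lev k) => z; ring.
  - move=> k ks; split; first exact: leq_bigmax_seq.
    have gk := sgood k ks; rewrite /G asboolT//.
    have [_ lv] := levP k gk; have [_ /andP[ck0 _] _] := cP k gk.
    have c20 : 0 <= (c k).2 by move: ck0; rewrite pmulr_rgt0// => /ltW.
    have -> : g ^- lev k = (2^-1 ^+ lev k) `^ u.
      rewrite exprn_powR// -exprVn /g -powRN -(mulN1r u) powRrM powR_inv1//.
    rewrite -powRM//; apply: ge0_ler_powR; rewrite ?nnegrE ?exprn_ge0 ?mulr_ge0//.
    by rewrite mulrA -natrM in lv.
have small : \sum_(k <- s) G k <= 2 * e.
  apply: (sum_enlarged_le e0 (F := fun k => diam_pow u (U k))) => //.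
  - by move=> k; exact: diam_pow_ge0.
  - by move=> k; rewrite /G; case: ifP => // _; exact: powR_ge0.
  - move=> k; rewrite /G; case: asboolP => [gk|_]; first by have [] := cP k gk.
    by apply: adde_ge0; [exact: diam_pow_ge0|rewrite lee_fin ltW].
  - exact: undup_uniq.
have {}main : 1 / 2 <= M * \sum_(k <- s) G k.
  by move: main; rewrite -mulr_sumr /M -[_ * 64 `^ u * _]mulrA.
move: main; apply/negP; rewrite -ltNge.
apply: (@le_lt_trans _ _ (M * (2 * e))); first by rewrite ler_wpM2l// ltW.
have -> : M * (2 * e) = 1 / 4 by rewrite /e; field; rewrite gt_eqF.
lra.
Qed.

End SumSets.

(** * Dimensions *)

Section Dimensions.
Context {K : realType} {d : nat}.
Implicit Types (A B : set 'rV[K]_d).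

Lemma pow2_prod (s t : K) :
  2 ^+ d * (2^-1 `^ s) * (2^-1 `^ t) = 2 `^ (d%:R - s - t).
Proof.
have h (x : K) : 2^-1 `^ x = 2 `^ (- x) by rewrite -(mulN1r x) powRrM powR_inv1.
have n2 (x : K) : (x == 0) ==> ((2 : K) != 0) by rewrite pnatr_eq0 implybT.
by rewrite !h -powR_mulrn// -!powRD.
Qed.

Lemma pow2_lt1 (x : K) : x < 0 -> 2 `^ x < 1.
Proof.
move=> x0; rewrite /powR (gt_eqF (ltr0n K 2)) expR_lt1.
by rewrite pmulr_llt0// ln_gt0// ltr1n.
Qed.

Lemma pow2_gt1 (x : K) : 0 < x -> 1 < 2 `^ x.
Proof.
move=> x0; rewrite /powR (gt_eqF (ltr0n K 2)) expR_gt1.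
by rewrite mulr_gt0// ln_gt0// ltr1n.
Qed.

Lemma hausdorff_measure_neq0 A (t : K) : 0 <= t -> t < hausdorff_dim A ->
  hausdorff_measure t A != 0%E.
Proof.
move=> t0; rewrite ltNge; apply: contraNN => /eqP h.
by apply: ge_inf; [exists 0 => x []|].
Qed.

Lemma hausdorff_dim_lt A (x : K) : compact A -> hausdorff_dim A < x ->
  exists u, [/\ 0 <= u, u < x & hausdorff_measure u A = 0%E].
Proof.
move=> /compact_in_cube[D AD] h.
have [|u [u0 Hu] ux] := inf_lt _ h; last by exists u.
by exists d.+1%:R; split => //; exact: hausdorff_measure_cube AD.
Qed.

Lemma fourier_dim_approx A (x : K) : (0 < d)%N -> A !=set0 -> x < fourier_dim A ->
  exists s, [/\ 0 <= s < d%:R, x < s, s <= fourier_dim A & fourier_approx A (2^-1 `^ s)].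
Proof.
move=> d0 A0; rewrite /fourier_dim; set S := [set s | _] => xS.
have Ssup s : S s -> s <= sup S.
  by apply: ub_le_sup; exists d%:R => z [/andP[_ /ltW]].
(* For negative [x] the exponent 0 suffices; this includes an empty [S], whose [sup] is 0. *)
have [x0|x0] := ltP x 0.
  exists 0; rewrite lexx ltr0n d0 x0 powRr0; split=> //.
    have [->|/set0P[s Ss]] := eqVneq S set0; first by rewrite sup0.
    by apply: le_trans (Ssup s Ss); case: Ss => /andP[/ltW].
  exact: fourier_approx1.
have S0 : S !=set0.
  by apply/set0P/eqP => S0; move: xS; rewrite S0 sup0 ltNge x0.
have [s Ss xs] := sup_gt S0 xS; exists s; split=> //.
- by case: Ss => /andP[/ltW -> ->].
- exact: Ssup.
have [/andP[s0 sd] [mu muA bnd]] := Ss.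
set E := ereal_sup _ in bnd.
have up xi : ((ComplexField.Normc.normc (fourier mu xi) ^+ 2 * enorm xi `^ s)%:E <= E)%E.
  by apply: ereal_sup_ubound; exists xi.
have [C EC] : exists C, E = C%:E.
  by move: bnd (up 0); case: E {up} => [r| |]//; exists r.
apply: (@fourier_decay_approx K d A s C mu) => //; first exact: ltW.
by move=> xi; have := up xi; rewrite EC lee_fin.
Qed.

Lemma hausdorff_dim_approx D B (x : K) : (0 < d)%N -> B !=set0 -> B `<=` in_cube D ->
  x < hausdorff_dim B ->
  exists t, [/\ 0 <= t, x < t, t = 0 \/ t < hausdorff_dim B &
    frostman_approx D B (2^-1 `^ t)].
Proof.
move=> d0 B0 BD xB; have [x0|x0] := ltP x 0.
  exists 0; split=> //; first by left.
  by rewrite powRr0; exact: frostman_approx1.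
have xt : x < (x + hausdorff_dim B) / 2 by lra.
have tB : (x + hausdorff_dim B) / 2 < hausdorff_dim B by lra.
have t0 := le_trans x0 (ltW xt).
exists ((x + hausdorff_dim B) / 2); split=> //; first by right.
exact: (frostman d0 t0 B0 BD (hausdorff_measure_neq0 t0 tB)).
Qed.

Lemma sum_set_compact A B : compact A -> compact B -> compact (sum_set A B).
Proof.
move=> cA cB; have -> : sum_set A B = (fun x => x.1 + x.2) @` (A `*` B).
  by apply/seteqP; split => [_ [x Ax [y By <-]]|_ [[x y] [/= Ax By] <-]];
    [exists (x, y)|exists x => //; exists y].
apply: continuous_compact; last exact: compact_setX.
by apply: continuous_subspaceT => z;
  exact: (@pseudometric_normed_Zmodule.add_continuous K 'rV[K]_d).
Qed.

(** Any [u] below the sum of the dimensions is exceeded by some [s + t] with admissible exponents,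
    each dimension giving up half of the gap. For the second claim, a smaller dimension of the sum
    set would provide a [u] of measure zero below that sum. *)
Lemma sum_set_dims A B : (0 < d)%N -> compact A -> compact B ->
  A !=set0 -> B !=set0 ->
  (d%:R < fourier_dim A + hausdorff_dim B -> (0 < lebesgue_rV (sum_set A B))%E) /\
  (fourier_dim A + hausdorff_dim B <= d%:R ->
    fourier_dim A + hausdorff_dim B <= hausdorff_dim (sum_set A B)).
Proof.
move=> d0 cA cB A0 B0; have cAB := sum_set_compact cA cB.
have [D BD] := compact_in_cube cB.
set f := fourier_dim A; set h := hausdorff_dim B.
have choice u : u < f + h -> exists s t, [/\ u < s + t, s < d%:R /\ s <= f,
    t = 0 \/ t < h, fourier_approx A (2^-1 `^ s) & frostman_approx D B (2^-1 `^ t)].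
  move=> ufh; pose e := (f + h - u) / 2.
  have fe : f - e < f by rewrite /e; lra.
  have he : h - e < h by rewrite /e; lra.
  have [s [/andP[s0 sd] es sf fA]] := fourier_dim_approx d0 A0 fe.
  have [t [t0 et th fB]] := hausdorff_dim_approx d0 B0 BD he.
  by exists s, t; split => //; move: es et; rewrite /e; lra.
have half0 (x : K) : 0 < 2^-1 `^ x by rewrite powR_gt0.
split=> [dfh|fhd].
  have [s [t [dst _ _ fA fB]]] := choice _ dfh.
  apply: (sum_set_volume (half0 s) (half0 t) BD fA fB cAB).
  by rewrite pow2_prod pow2_lt1//; lra.
rewrite leNgt; apply/negP => /(hausdorff_dim_lt cAB)[u [u0 ufh Hu]].
have [s [t [ust [sd sf] th fA fB]]] := choice _ ufh.
(* Strictness comes from [t < h] when that holds, and from [s < d] when [t = 0]. *)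
have st : s + t < d%:R by case: th => [->|th]; lra.
have := sum_set_content (half0 s) (half0 t) BD fA fB cAB u0.
rewrite Hu eqxx => H.
suff : false by [].
apply: H; first by rewrite pow2_prod pow2_gt1//; lra.
have h2 (x : K) : 2^-1 `^ x = 2 `^ (- x) by rewrite -(mulN1r x) powRrM powR_inv1.
have n2 (x : K) : (x == 0) ==> ((2 : K) != 0) by rewrite pnatr_eq0 implybT.
by rewrite !h2 -!powRD// pow2_lt1//; lra.
Qed.

Lemma sum_setC A B : sum_set A B = sum_set B A.
Proof.
by apply/seteqP; split => _ [x ? [y ? <-]]; exists y => //; exists x => //; rewrite addrC.
Qed.

Lemma scale_set_compact (R : set K) (Y : set 'rV[K]_d) : compact R -> compact Y ->
  compact (scale_set R Y).
Proof.
move=> cR cY; have -> : scale_set R Y = (fun x : K * 'rV[K]_d => x.1 *: x.2) @` (R `*` Y).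
  by apply/seteqP; split => [_ [x Ax [y By <-]]|_ [[x y] [/= Ax By] <-]];
    [exists (x, y)|exists x => //; exists y].
apply: continuous_compact; last exact: compact_setX.
by apply: continuous_subspaceT => z; exact: (@scale_continuous K 'rV[K]_d).
Qed.

End Dimensions.

Theorem theorem1p1 (K : realType) (d : nat) (R : set K) (Y Z : set 'rV[K]_d)
  (d_ge1 : (1 <= d)%N)
  (R_pos : R `<=` [set r | 0 < r])
  (R_neq0 : R !=set0) (Y_neq0 : Y !=set0) (Z_neq0 : Z !=set0)
  (R_compact : compact R) (Y_compact : compact Y) (Z_compact : compact Z) :
  let RY := scale_set R Y in
  let delta := Num.max (fourier_dim RY + hausdorff_dim Z)
                       (hausdorff_dim RY + fourier_dim Z) in
  (d%:R < delta -> (0 < lebesgue_rV (sum_set RY Z))%E) /\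
  (delta <= d%:R -> delta <= hausdorff_dim (sum_set RY Z)).
Proof.
move=> RY delta.
have cRY : compact RY by exact: scale_set_compact.
have RY0 : RY !=set0.
  have [r Rr] := R_neq0; have [y Yy] := Y_neq0.
  by exists (r *: y); exists r => //; exists y.
have [vol1 dim1] := sum_set_dims d_ge1 cRY Z_compact RY0 Z_neq0.
(* Exchanging the two sets yields the second term of the maximum. *)
have [vol2 dim2] := sum_set_dims d_ge1 Z_compact cRY Z_neq0 RY0.
rewrite (sum_setC Z) (addrC (fourier_dim Z)) in vol2 dim2.
split; first by rewrite lt_max => /orP[/vol1|/vol2].
by rewrite !ge_max => /andP[/dim1 -> /dim2 ->].
Qed.
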